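(* Let $a,b,c\in\mathbb{R}\setminus\{0\}$ and let $W$ be the $3\times 3$ weight matrix on $\mathbb{R}$ $$W(x) = e^{-x^{2}}\begin{pmatrix} e^{2bx} + a^{2}x^{2} & ax & acx^{2} \\ ax & 1 & cx \\ acx^{2} & cx & c^{2}x^{2} + 1 \end{pmatrix}.$$ Then $W$ is not a Darboux transformation of any direct sum of classical scalar weights.
   Context: Weight matrices: an $N\times N$ weight matrix supported on a (possibly unbounded) interval $(x_0,x_1)$ is a matrix-valued function $W$, smooth on $(x_0,x_1)$, Hermitian positive definite almost everywhere on $(x_0,x_1)$, zero outside $(x_0,x_1)$, and with finite moments of all orders. Put $\langle P,Q\rangle_W=\int_{x_0}^{x_1}P(x)W(x)Q(x)^*\,dx$ for $P,Q\in\operatorname{Mat}_N(\mathbb{C}[x])$. The monic orthogonal polynomials of $W$ are the unique sequence $\{P_n\}_{n\ge0}$ with $P_n$ monic of degree $n$ and $\langle P_n,P_m\rangle_W=0$ for $n\ne m$. Classical scalar weights: up to an affine change of the variable (and positive scalar multiples), the Hermite weight $e^{-x^2}$ on $\mathbb{R}$, the Laguerre weights $x^{\alpha}e^{-x}$ on $(0,\infty)$ with $\alpha>-1$, and the Jacobi weights $(1-x)^{\alpha}(1+x)^{\beta}$ on $(-1,1)$ with $\alpha,\beta>-1$. A direct sum of classical scalar weights is a weight matrix $\operatorname{diag}(w_1,\dots,w_N)$ with each $w_i$ a classical scalar weight (here $N=3$). Differential operators: $\operatorname{Mat}_N(\Omega[x])$ is the algebra of operators $D=\sum_{j=0}^m\partial^jF_j(x)$,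 $\partial=\frac{d}{dx}$, $F_j\in\operatorname{Mat}_N(\mathbb{C}[x])$, acting on the right: $P\cdot D=\sum_j\partial^j(P)(x)F_j(x)$, with $P\cdot(DE)=(P\cdot D)\cdot E$ (multiplication on the right by a function is an operator of order $0$; the same conventions are used for operators with rational coefficients). Right Fourier algebra: for a weight matrix $W$ with monic orthogonal polynomials $P_n$, $\mathcal{F}_R(W)$ is the set of $\mathfrak{D}\in\operatorname{Mat}_N(\Omega[x])$ for which there exist integers $\ell,k\ge 0$ and sequences $A_j(n)\in\operatorname{Mat}_N(\mathbb{C})$, $-\ell\le j\le k$, $n\ge 0$, such that $P_n(x)\cdot\mathfrak{D}=\sum_{j=-\ell}^kA_j(n)P_{n+j}(x)$ for all $n\ge0$ (with $P_m=0$ for $m<0$). Darboux transformation: let $V$ and $\widetilde V$ be $N\times N$ weight matrices with monic orthogonal polynomials $P_n$ and $\widetilde P_n$. $\widetilde V$ is a Darboux transformation of $V$ if there exist $\mathfrak{D},\widetilde{\mathfrak{D}}\in\mathcal{F}_R(V)$, nonzero polynomials $F(x),\widetilde F(x)$, and sequences of matrices $C_n,\widetilde C_n\in\operatorname{Mat}_N(\mathbb{C})$, nonsingular for all but finitely many $n$, such that for all $n$ $$C_n\widetilde P_n(x)=P_n(x)\cdot\mathfrak{D}F(x)^{-1},\qquad \widetilde C_nP_n(x)=\widetilde P_n(x)\cdot\widetilde F(x)^{-1}\widetilde{\mathfrak{D}}.$$ *)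

(* Defs.v *)
From HB Require Import structures.
From mathcomp Require Import all_boot all_order all_algebra.
From mathcomp Require Import complex ring.
From mathcomp Require Import all_classical all_reals all_analysis.

Set Implicit Arguments.
Unset Strict Implicit.
Unset Printing Implicit Defensive.

Import Order.TTheory GRing.Theory Num.Theory.
Import numFieldNormedType.Exports.

Local Open Scope classical_set_scope.
Local Open Scope complex_scope.
Local Open Scope ring_scope.

Definition smooth_on (R : realType) (D : set R) (f : R -> R) : Prop :=
  forall (n : nat) (x : R), D x -> derivable (derive1n n f) x 1.

Definition adjmx (R : realType) m n (M : 'M[R[i]]_(m, n)) : 'M[R[i]]_(n, m) :=
  map_mx Num.conj M^T.

Definition posdefmx (R : realType) N (M : 'M[R[i]]_N) : Prop :=
  M \is hermsymmx /\
  forall v : 'rV[R[i]]_N, v != 0 -> 0 < (v *m M *m adjmx v) ord0 ord0.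

(* A matrix-valued function on the line, together with the (possibly infinite)
   end points of the interval which is meant to support it. *)
Record matrix_fun (R : realType) (N : nat) := MatrixFun {
  lower : \bar R;
  upper : \bar R;
  mfun :> R -> 'M[R[i]]_N }.

Definition supp (R : realType) N (W : matrix_fun R N) : set R :=
  [set x | (lower W < x%:E)%E /\ (x%:E < upper W)%E].

Definition is_weight_matrix (R : realType) N (W : matrix_fun R N) : Prop :=
  [/\ (lower W < upper W)%E,
      forall i j, smooth_on (supp W) (fun x => complex.Re (W x i j)) /\
                  smooth_on (supp W) (fun x => complex.Im (W x i j)),
      {ae @lebesgue_measure R, forall x, supp W x -> posdefmx (W x)},
      forall x, ~ supp W x -> W x = 0 &
      forall (n : nat) i j,
        (@lebesgue_measure R).-integrable (supp W)
          (EFin \o (fun x => x ^+ n * complex.Re (W x i j))) /\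
        (@lebesgue_measure R).-integrable (supp W)
          (EFin \o (fun x => x ^+ n * complex.Im (W x i j)))].

(* A matrix polynomial is represented by a matrix with polynomial entries. *)

Definition cintegral (R : realType) (D : set R) (f : R -> R[i]) : R[i] :=
  (\int[@lebesgue_measure R]_(x in D) complex.Re (f x))
  +i* (\int[@lebesgue_measure R]_(x in D) complex.Im (f x)).

Definition evalmx (R : realType) N (P : 'M[{poly R[i]}]_N) (x : R) :
    'M[R[i]]_N :=
  map_mx (fun p : {poly R[i]} => p.[x%:C]) P.

Definition inner (R : realType) N (W : matrix_fun R N)
    (P Q : 'M[{poly R[i]}]_N) : 'M[R[i]]_N :=
  \matrix_(i, j)
    cintegral (supp W) (fun x => (evalmx P x *m W x *m adjmx (evalmx Q x)) i j).

Definition monic_of_degree (R : realType) N (n : nat)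
    (P : 'M[{poly R[i]}]_N) : Prop :=
  forall i j, (size ((P - ('X^n)%:M) i j)%R <= n)%N.

Definition is_monic_orthogonal (R : realType) N (W : matrix_fun R N)
    (P : nat -> 'M[{poly R[i]}]_N) : Prop :=
  (forall n, monic_of_degree n (P n)) /\
  (forall n m, n != m -> inner W (P n) (P m) = 0).

(* The sequence [:: F_0; ...; F_m] stands for \sum_j \partial^j F_j; [d] is
   the derivation of the ring of entries. *)
Definition act (A : nzRingType) (d : A -> A) N (P : 'M[A]_N)
    (D : seq 'M[A]_N) : 'M[A]_N :=
  \sum_(j < size D) map_mx (iter j d) P *m D`_j.

Definition poly_act (R : realType) N (P : 'M[{poly R[i]}]_N)
    (D : seq 'M[{poly R[i]}]_N) : 'M[{poly R[i]}]_N :=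
  act (@deriv R[i]) P D.

Local Notation "p %:F" := (@tofrac _ p).

(* The quotient rule, applied to a representative; [frac_derivE] shows that
   the choice of the representative does not matter. *)
Definition frac_deriv (K : fieldType) (f : {fraction {poly K}}) :
    {fraction {poly K}} :=
  let p := (frac (repr f)).1 in let q := (frac (repr f)).2 in
  (deriv p * q - p * deriv q)%:F / (q ^+ 2)%:F.

Lemma frac_derivE (K : fieldType) (p q : {poly K}) : q != 0 ->
  frac_deriv (p%:F / q%:F) = (deriv p * q - p * deriv q)%:F / (q ^+ 2)%:F.
Proof.
move=> q0; rewrite /frac_deriv.
have F0 (x : {poly K}) : x != 0 -> x%:F != 0 by rewrite tofrac_eq0.
have -> : p%:F / q%:F = \pi_({fraction {poly K}})%qT (Ratio p q).
  unlock tofrac; rewrite -[X in _ * X]FracField.pi_inv -[LHS]FracField.pi_mul.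
  by rewrite /FracField.mulf /FracField.invf !numden_Ratio ?oner_neq0 ?mulr1 ?mul1r.
have := FracField.equivf_l (Ratio p q); rewrite !numden_Ratio//.
set r := repr _; set p1 := (frac r).1; set q1 := (frac r).2 => E.
have q10 : q1 != 0 by exact: denom_ratioP.
have dE : deriv p1 * q + p1 * deriv q = deriv q1 * p + q1 * deriv p.
  by rewrite -!derivM E.
apply/eqP; rewrite eqr_div ?F0 ?expf_neq0// -!tofracM tofrac_eq; apply/eqP.
transitivity (q * q1 * (deriv p1 * q) - (p1 * q) * (deriv q1 * q)); first by ring.
have -> : deriv p1 * q = deriv q1 * p + q1 * deriv p - p1 * deriv q.
  by rewrite -dE; ring.
transitivity (q * q1 * (deriv q1 * p + q1 * deriv p) -
              (p1 * q) * (q1 * deriv q + deriv q1 * q)); first by ring.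
by rewrite E; ring.
Qed.

Definition rat_act (R : realType) N (P : 'M[{fraction {poly R[i]}}]_N)
    (D : seq 'M[{fraction {poly R[i]}}]_N) : 'M[{fraction {poly R[i]}}]_N :=
  act (@frac_deriv R[i]) P D.

Definition to_rat (R : realType) N (P : 'M[{poly R[i]}]_N) :
    'M[{fraction {poly R[i]}}]_N :=
  map_mx (@tofrac {poly R[i]}) P.

(* The operator of order 0 given by right multiplication by F(x)^{-1}. *)
Definition mul_inv (R : realType) N (F : {poly R[i]}) :
    seq 'M[{fraction {poly R[i]}}]_N :=
  [:: ((F%:F)^-1)%:M].

Definition cst_mx (R : realType) N (M : 'M[R[i]]_N) : 'M[{poly R[i]}]_N :=
  map_mx polyC M.

Definition extend0 (V : zmodType) (P : nat -> V) (m : int) : V :=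
  if m is Posz k then P k else 0.

(* Membership in the right Fourier algebra of the weight whose monic orthogonal
   polynomials are [P]; the shift j of the sum is i - l. *)
Definition right_fourier (R : realType) N (P : nat -> 'M[{poly R[i]}]_N)
    (D : seq 'M[{poly R[i]}]_N) : Prop :=
  exists (l k : nat) (A : int -> nat -> 'M[R[i]]_N),
    forall n : nat,
      poly_act (P n) D =
      \sum_(i < (l + k).+1)
        cst_mx (A (i%:Z - l%:Z) n) *m extend0 P (n%:Z + (i%:Z - l%:Z)).

(* Each weight matrix has exactly one sequence of monic orthogonal polynomials,
   so [P] and [Pt] below are determined by [V] and [Vt]. *)
Definition is_darboux (R : realType) N (V Vt : matrix_fun R N) : Prop :=
  exists P Pt : nat -> 'M[{poly R[i]}]_N,
  [/\ is_monic_orthogonal V P, is_monic_orthogonal Vt Pt &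
  exists (D Dt : seq 'M[{poly R[i]}]_N) (F Ft : {poly R[i]})
    (C Ct : nat -> 'M[R[i]]_N),
  [/\ right_fourier P D /\ right_fourier P Dt,
      F != 0 /\ Ft != 0,
      finite_set [set n | C n \notin unitmx] /\
      finite_set [set n | Ct n \notin unitmx],
      forall n, to_rat (cst_mx (C n) *m Pt n) =
        rat_act (rat_act (to_rat (P n)) [seq to_rat G | G <- D]) (mul_inv N F) &
      forall n, to_rat (cst_mx (Ct n) *m P n) =
        rat_act (rat_act (to_rat (Pt n)) (mul_inv N Ft))
          [seq to_rat G | G <- Dt]]].

(* Each model is extended by zero outside its open interval, so that an affine
   change of variable also transports the support. *)
Inductive classical_model (R : realType) : (R -> R) -> Prop :=
| Hermite : classical_model (fun x => expR (- x ^+ 2))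
| Laguerre (alpha : R) of -1 < alpha :
    classical_model (fun x => if 0 < x then x `^ alpha * expR (- x) else 0)
| Jacobi (alpha beta : R) of -1 < alpha & -1 < beta :
    classical_model (fun x =>
      if -1 < x < 1 then (1 - x) `^ alpha * (1 + x) `^ beta else 0).

Definition is_classical_weight (R : realType) (w : R -> R) : Prop :=
  exists (w0 : R -> R) (k s t : R),
    [/\ classical_model w0, 0 < k, s != 0 & forall x, w x = k * w0 (s * x + t)].

(* A weight matrix is positive definite almost everywhere on its interval and
   zero elsewhere, so the first conjunct makes all w_i live on one interval. *)
Definition is_classical_direct_sum (R : realType) N (V : matrix_fun R N) :
    Prop :=
  is_weight_matrix V /\
  exists w : 'I_N -> R -> R,
    (forall i, is_classical_weight (w i)) /\
    forall x, V x = diag_mx (\row_i (w i x)%:C).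

Definition W_entries (R : realType) (a b c x : R) : seq (seq R) :=
  [:: [:: expR (2 * b * x) + a ^+ 2 * x ^+ 2; a * x; a * c * x ^+ 2];
      [:: a * x;                              1;     c * x];
      [:: a * c * x ^+ 2;                     c * x; c ^+ 2 * x ^+ 2 + 1]].

Definition W_example (R : realType) (a b c : R) : matrix_fun R 3 :=
  MatrixFun -oo%E +oo%E (fun x =>
    \matrix_(i, j)
      (expR (- x ^+ 2) * nth 0 (nth [::] (W_entries a b c x) i) j)%:C).

(* Main.v *)
Require Import Defs.
From HB Require Import structures.
From mathcomp Require Import all_boot all_order all_algebra.
From mathcomp Require Import complex ring lra.
From mathcomp Require Import all_classical all_reals all_analysis measurable_realfun.

Set Implicit Arguments.
Unset Strict Implicit.
Unset Printing Implicit Defensive.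

Import Order.TTheory GRing.Theory Num.Theory.
Import numFieldNormedType.Exports.

Local Open Scope classical_set_scope.
Local Open Scope complex_scope.
Local Open Scope ring_scope.

(** Let [g] and [h] be integration against [e^(-x^2+2bx)] and [e^(-x^2)], seen as
    linear functionals on polynomials, so that [W = Wg g + Wh h] with polynomial
    matrices [Wg] and [Wh], and let [v_k] be integration against the [k]-th
    classical weight of [V]. The Darboux relation says that an operator [D] maps
    [P_n] to [F C_n Q_n], where [P_n] and [Q_n] are the orthogonal polynomials of
    [V] and [W]. Integrating by parts, pairing row [k] of [D] with any polynomial
    through [W] is a functional [a g + b h] with [a], [b] polynomials, and by
    orthogonality it equals [q v_k] for a polynomial [q]. As [v_k] satisfies a
    Pearson equation and [g], [h] satisfy first order equations with different
    logarithmic derivatives, comparing degrees shows that [a] and [b] cannot both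
    be nonzero. Hence the [k]-th row of [D], applied to any polynomial, lies in
    the left kernel of [Wg] or of [Wh]. The first kernel consists of the rows
    whose first entry is zero, the second one is spanned by [(1, - a x, 0)], so
    in both cases the first entry never reaches the top degree. The leading
    coefficient [C_n] thus has a zero first column for every [n], although it
    should be invertible for almost all [n]. *)

(** * Polynomial functionals with first order equations *)

Section Functionals.
Variable K : fieldType.
Implicit Types (u v : {scalar {poly K}}) (l p q : {poly K}).

(** Nondegeneracy of the bilinear form [u (p * q)]: a polynomial multiple of [u] vanishes only if
    the multiplier does. *)
Definition separating u := forall q, (forall p, u (p * q) = 0) -> q = 0.

(** Weak form of the Pearson equation [(phi w)' = psi w]: for integration against [w], the integrand
    is the derivative of [phi w p]. When [phi = 1], [psi] is the logarithmic derivative of [w]. *)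
Definition pearson_functional u (phi psi : {poly K}) :=
  forall p, u (phi * p^`() + psi * p) = 0.

Lemma pearson_adjoint u l p q : pearson_functional u 1 l ->
  u (p^`() * q) = u (p * - (q^`() + l * q)).
Proof.
move=> /(_ (p * q)); rewrite mul1r derivM => E.
apply/eqP; rewrite -subr_eq0 -raddfB -[X in _ == X]E; apply/eqP; congr (u _).
by ring.
Qed.

Variables (g h : {scalar {poly K}}) (l : {poly K}) (d : K).
Hypotheses (d0 : d != 0) (gl : pearson_functional g 1 (l + d%:P))
  (hl : pearson_functional h 1 l).
Hypotheses (ndg : separating g) (ndh : separating h).

(* Applying the operator p |-> p' + l p to the relation replaces (a, b) by
   (a' + d a, b'), which preserves the degree of a and lowers that of b. *)
Lemma functionals_independent a b :
  (forall p, g (p * a) + h (p * b) = 0) -> a = 0 /\ b = 0.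
Proof.
have [n] := ubnP (size b); elim: n a b => // n IH a b sb H.
have [b0|b0] := eqVneq b 0.
  by split=> //; apply: ndg => p; have := H p; rewrite b0 mulr0 raddf0 addr0.
have [] := IH (a^`() + d *: a) b^`() _ _.
- by apply: leq_trans (lt_size_deriv b0) _.
- move=> p; have := H (p^`() + l * p).
  have -> : (p^`() + l * p) * b = p^`() * b + p * (l * b) by ring.
  have -> : (p^`() + l * p) * a = p^`() * a + p * (l * a) by ring.
  rewrite !raddfD /= (pearson_adjoint _ _ gl) (pearson_adjoint _ _ hl).
  rewrite -!raddfD/= => E; apply/oppr_inj; rewrite oppr0 -[RHS]E opprD -!raddfN.
  by congr (g _ + h _); rewrite -?mul_polyC; ring.
move=> /eqP a'; have a0 : a = 0.
  apply/eqP; apply: contraTT a' => a0.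
  rewrite -size_poly_eq0 addrC size_polyDl ?size_scale// ?size_poly_eq0//.
  exact: lt_size_deriv.
move=> _; split=> //; apply: ndh => p.
by have := H p; rewrite a0 mulr0 raddf0 add0r.
Qed.

(* The two parts a g and b h solve the same first order equation as q v, so
   that their Wronskian would have the same degree as a b. *)
Lemma pearson_mixture v phi psi q a b : pearson_functional v phi psi ->
  phi != 0 -> (forall p, v (p * q) = g (p * a) + h (p * b)) ->
  a = 0 \/ b = 0.
Proof.
move=> vpsi phi0 H.
have [|a0] := eqVneq a 0; [by left|have [|b0] := eqVneq b 0; [by right|]].
have q0 : q != 0.
  apply: contra_neq a0 => q0; have [] // := @functionals_independent a b.
  by move=> p; rewrite -H q0 mulr0 raddf0.
(* These come from the test polynomial [p q^2] in the equation of [v]: [phi (p q^2)' + psi p q^2 =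
   (p' X + p Y) q], and the remaining factor [q] lets [H] replace [v] by [g] and [h]. *)
pose X := phi * q; pose Y := 2%:R * (phi * q^`()) + psi * q.
have X0 : X != 0 by rewrite mulf_neq0.
have [] := @functionals_independent (Y * a - ((X * a)^`() + (l + d%:P) * (X * a)))
  (Y * b - ((X * b)^`() + l * (X * b))).
  move=> p; have := vpsi (p * q * q).
  rewrite (_ : _ + _ = (p^`() * X + p * Y) * q); last first.
    by rewrite !derivM /X /Y; ring.
  rewrite H => E; rewrite -[RHS]E.
  have sp (t : {poly K}) : (p^`() * X + p * Y) * t = p^`() * (X * t) + p * (Y * t).
    by ring.
  rewrite !sp !mulrBr !raddfD/= (pearson_adjoint _ _ gl) (pearson_adjoint _ _ hl).
  by rewrite !mulrN; ring.
(* Eliminating [Y] between the two equations also removes [l], and leaves only the difference [d] of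
   the logarithmic derivatives. *)
move=> Ea Eb; have : X * (a^`() * b - a * b^`() + d%:P * (a * b)) = 0.
  have -> : X * (a^`() * b - a * b^`() + d%:P * (a * b)) =
     a * (Y * b - ((X * b)^`() + l * (X * b)))
     - b * (Y * a - ((X * a)^`() + (l + d%:P) * (X * a))).
    by rewrite !derivM; ring.
  by rewrite Ea Eb !mulr0 subr0.
move=> /eqP; rewrite mulf_eq0 (negPf X0)/= => /eqP.
move=> /(congr1 (fun p : {poly K} => size p)).
have sab : size (d%:P * (a * b)) = (size a + size b).-1.
  by rewrite mul_polyC size_scale// size_mul.
rewrite addrC size_polyDl ?size_poly0 ?sab.
  have := a0; rewrite -size_poly_gt0; case: (size a) => //= n _.
  by move/eqP; rewrite addn_eq0 size_poly_eq0 (negPf b0) andbF.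
apply: leq_ltn_trans (size_polyD _ _) _; rewrite gtn_max size_polyN.
have da := lt_size_deriv a0; have db := lt_size_deriv b0.
rewrite -!size_poly_gt0 in a0 b0.
apply/andP; split; apply: leq_ltn_trans (size_polyMleq _ _) _.
  by rewrite -!subn1 ltn_sub2rE ?ltn_add2r// addn_gt0 b0 orbT.
by rewrite -!subn1 ltn_sub2rE ?ltn_add2l// addn_gt0 a0.
Qed.

End Functionals.

(** * Matrix polynomials, operators and diagonal pairings *)

Section MatrixPolynomials.
Variables (K : fieldType) (N : nat).
Implicit Types (u : {scalar {poly K}}) (X Y : 'M[K]_N) (P Q S : 'M[{poly K}]_N).

Local Notation cmx X := (map_mx polyC X).

Definition size_le n Q := forall i j, (size (Q i j) <= n)%N.

Lemma size_le_trans m n Q : (m <= n)%N -> size_le m Q -> size_le n Q.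
Proof. by move=> mn Qm i j; apply: leq_trans (Qm i j) mn. Qed.

Lemma size_le_ex Q : exists n, size_le n Q.
Proof.
exists (\max_(ij : 'I_N * 'I_N) size (Q ij.1 ij.2)) => i j.
exact: (leq_bigmax_cond (F := fun ij => size (Q ij.1 ij.2)) (i, j)).
Qed.

Lemma size_le_add n P Q : size_le n P -> size_le n Q -> size_le n (P + Q).
Proof.
move=> hP hQ i j; rewrite mxE; apply: leq_trans (size_polyD _ _) _.
by rewrite geq_max hP hQ.
Qed.

Lemma size_le_cmul n X Q : size_le n Q -> size_le n (cmx X *m Q).
Proof.
move=> hQ i j; rewrite mxE; apply: leq_trans (size_sum _ _ _) _.
apply/bigmax_leqP => k _; rewrite mxE mul_polyC.
by apply: leq_trans (size_scale_leq _ _) (hQ _ _).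
Qed.

(** Subtracting the matrix of coefficients of ['X^n] times [P n] lowers the size bound by one. The
    coefficients stand on the left, where [act] and [diag_pair] are linear. *)
Lemma monic_span (P : nat -> 'M[{poly K}]_N) :
  (forall n, size_le n (P n - ('X^n)%:M)) ->
  forall n Q, size_le n Q ->
  exists X : nat -> 'M[K]_N, Q = \sum_(m < n) cmx (X m) *m P m.
Proof.
move=> monP; elim=> [|n IH] Q hQ.
  exists (fun=> 0); rewrite big_ord0; apply/matrixP => i j; rewrite !mxE.
  by apply/eqP; rewrite -size_poly_eq0 -leqn0.
pose Xn := map_mx (fun p : {poly K} => p`_n) Q.
have [|X E] := IH (Q - cmx Xn *m P n).
  have -> : Q - cmx Xn *m P n =
      (Q - cmx Xn *m ('X^n)%:M) + cmx (- Xn) *m (P n - ('X^n)%:M).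
    rewrite map_mxN mulNmx mulmxBr; apply/matrixP => i j; rewrite !mxE; ring.
  apply: size_le_add; last exact: size_le_cmul.
  move=> i j; rewrite mul_mx_scalar !mxE; apply/leq_sizeP => k.
  rewrite coefB mulrC coefCM coefXn leq_eqVlt => /predU1P[<-|nk].
    by rewrite eqxx mulr1 subrr.
  by rewrite gtn_eqF// mulr0 subr0 nth_default// (leq_trans (hQ i j)).
exists (fun m => if m == n then Xn else X m).
rewrite big_ord_recr/= eqxx; apply/eqP; rewrite -subr_eq E; apply/eqP.
by apply: eq_bigr => m _; rewrite ltn_eqF.
Qed.

Lemma map_functionalMl u X Q : map_mx u (cmx X *m Q) = X *m map_mx u Q.
Proof.
apply/matrixP => i j; rewrite !mxE raddf_sum; apply: eq_bigr => k _.
by rewrite !mxE mul_polyC /= scalarZ.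
Qed.

Lemma map_functionalMr u X Q : map_mx u (Q *m cmx X) = map_mx u Q *m X.
Proof.
apply/matrixP => i j; rewrite !mxE raddf_sum; apply: eq_bigr => k _.
by rewrite !mxE mulrC mul_polyC /= scalarZ mulrC.
Qed.

Local Notation act := (act (@deriv K)).

Lemma actD P Q (D : seq 'M[{poly K}]_N) : act (P + Q) D = act P D + act Q D.
Proof.
rewrite /Defs.act -big_split/=; apply: eq_bigr => j _; rewrite -mulmxDl; congr (_ *m _).
by apply/matrixP => i k; rewrite !mxE -!/(derivn _ _) derivnD.
Qed.

Lemma act0 (D : seq 'M[{poly K}]_N) : act 0 D = 0.
Proof. by apply: (@addIr _ (act 0 D)); rewrite -actD !add0r. Qed.

Lemma act_cmul X Q (D : seq 'M[{poly K}]_N) : act (cmx X *m Q) D = cmx X *m act Q D.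
Proof.
rewrite /Defs.act mulmx_sumr; apply: eq_bigr => j _; rewrite mulmxA.
congr (_ *m _); apply/matrixP => i k; rewrite !mxE -!/(derivn _ _) raddf_sum/=.
by apply: eq_bigr => m _; rewrite !mxE !mul_polyC -!/(derivn _ _) derivnZ.
Qed.

Lemma act_sum I r (F : I -> 'M[{poly K}]_N) (D : seq 'M[{poly K}]_N) :
  act (\sum_(i <- r) F i) D = \sum_(i <- r) act (F i) D.
Proof.
by apply: (big_morph (fun P => act P D)) => [P Q|]; [exact: actD|exact: act0].
Qed.

(** Integration by parts moves [D] off [P]: the term of order [s] becomes multiplication by the
    [s]-fold iterate of [p |-> - (p' + l p)] applied to [D_s S]. *)
Lemma act_adjoint u l (D : seq 'M[{poly K}]_N) S : pearson_functional u 1 l ->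
  exists A : 'M[{poly K}]_N, forall P, map_mx u (act P D *m S) = map_mx u (P *m A).
Proof.
move=> ul; pose adj s := iter s (fun p : {poly K} => - (p^`() + l * p)).
have adjE s p q : u (iter s (@deriv K) p * q) = u (p * adj s q).
  elim: s p q => // s IH p q.
  by rewrite iterS (pearson_adjoint _ _ ul) IH /adj -iterSr.
exists (\sum_(s < size D) map_mx (adj s) (D`_s *m S)) => P.
rewrite /Defs.act mulmx_suml mulmx_sumr.
apply/matrixP => i j; rewrite !mxE !summxE !raddf_sum; apply: eq_bigr => s _.
rewrite -mulmxA !mxE !raddf_sum; apply: eq_bigr => k _.
by rewrite !mxE /= adjE.
Qed.

(** Bilinear form of the inner product of a diagonal weight. Conjugation is left to the second
    argument, so that any field [K] is allowed. *)
Definition diag_pair (v : 'I_N -> {scalar {poly K}}) P S : 'M[K]_N :=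
  \matrix_(i, j) \sum_k v k (P i k * S k j).

Lemma diag_pair0 v P : diag_pair v P 0 = 0.
Proof.
apply/matrixP => i j; rewrite !mxE big1// => k _; by rewrite mxE mulr0 raddf0.
Qed.

Lemma diag_pairDr v P S T : diag_pair v P (S + T) = diag_pair v P S + diag_pair v P T.
Proof.
apply/matrixP => i j; rewrite !mxE -big_split; apply: eq_bigr => k _.
by rewrite !mxE mulrDr raddfD.
Qed.

Lemma diag_pairDl v P Q S : diag_pair v (P + Q) S = diag_pair v P S + diag_pair v Q S.
Proof.
apply/matrixP => i j; rewrite !mxE -big_split; apply: eq_bigr => k _.
by rewrite !mxE mulrDl raddfD.
Qed.

Lemma diag_pair_cmull v X P S : diag_pair v (cmx X *m P) S = X *m diag_pair v P S.
Proof.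
apply/matrixP => i j; rewrite !mxE; under [RHS]eq_bigr do rewrite mxE mulr_sumr.
rewrite exchange_big; apply: eq_bigr => k _; rewrite mxE mulr_suml raddf_sum.
by apply: eq_bigr => m _; rewrite !mxE mul_polyC -scalerAl /= scalarZ.
Qed.

Lemma diag_pair_cmulr v X P S : diag_pair v P (S *m cmx X) = diag_pair v P S *m X.
Proof.
apply/matrixP => i j; rewrite !mxE; under [RHS]eq_bigr do rewrite mxE mulr_suml.
rewrite exchange_big; apply: eq_bigr => k _; rewrite mxE mulr_sumr raddf_sum.
apply: eq_bigr => m _; rewrite !mxE [S _ _ * _]mulrC mul_polyC -scalerAr /= scalarZ.
exact: mulrC.
Qed.

(* If a left linear functional L kills P n for large n, then it is the pairing
   with a polynomial matrix, since the Gram matrices of P are invertible. *)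
Lemma diag_pair_represent v (P Pd : nat -> 'M[{poly K}]_N)
    (L : 'M[{poly K}]_N -> 'M[K]_N) M :
  (forall n, size_le n (P n - ('X^n)%:M)) ->
  (forall n m, n != m -> diag_pair v (P n) (Pd m) = 0) ->
  (forall n, diag_pair v (P n) (Pd n) \in unitmx) ->
  {morph L : Q Q' / Q + Q'} -> (forall X Q, L (cmx X *m Q) = X *m L Q) ->
  (forall n, (M <= n)%N -> L (P n) = 0) ->
  exists S, forall Q, L Q = diag_pair v Q S.
Proof.
move=> monP orth gram LD LZ LM.
have [S HS] : exists S, forall n, diag_pair v (P n) S =
    if (n < M)%N then L (P n) else 0.
  elim: M {LM} => [|M [S HS]]; first by exists 0 => n; rewrite diag_pair0.
  (* By orthogonality the added multiple of [Pd M] changes the pairing with [P M] only, and the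
     inverse Gram matrix adjusts that one. *)
  exists (S + Pd M *m cmx (invmx (diag_pair v (P M) (Pd M)) *m L (P M))) => n.
  rewrite diag_pairDr diag_pair_cmulr HS ltnS.
  have [->|nM] := eqVneq n M.
    by rewrite ltnn leqnn add0r mulmxA mulmxV ?mul1mx.
  by rewrite orth// mul0mx addr0 (leq_eqVlt n M) (negPf nM).
exists S => Q; have [n /(monic_span monP)[X ->]] := size_le_ex Q.
have L0 : L 0 = 0 by apply: (@addIr _ (L 0)); rewrite -LD !add0r.
have p0 : diag_pair v 0 S = 0.
  by apply: (@addIr _ (diag_pair v 0 S)); rewrite -diag_pairDl !add0r.
rewrite (big_morph L LD L0).
rewrite (big_morph (fun Q => diag_pair v Q S) (fun _ _ => diag_pairDl v _ _ _) p0).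
apply: eq_bigr => m _; rewrite LZ diag_pair_cmull HS; case: ltnP => // /LM ->.
by [].
Qed.

Variables (g h : {scalar {poly K}}) (l : {poly K}) (d : K).
Hypotheses (d0 : d != 0) (gl : pearson_functional g 1 (l + d%:P))
  (hl : pearson_functional h 1 l).
Hypotheses (ndg : separating g) (ndh : separating h).

Lemma separating_mx u Q : separating u ->
  (forall S, map_mx u (Q *m S) = 0) -> Q = 0.
Proof.
move=> ndu H; apply/matrixP => i j; rewrite mxE; apply: ndu => p.
have /matrixP/(_ i j) := H (p *: delta_mx j j); rewrite !mxE => E.
rewrite -[RHS]E; congr (u _); rewrite (bigD1 j)//= big1 => [|k kj].
  by rewrite !mxE !eqxx mulr1 addr0 mulrC.
by rewrite !mxE (negPf kj) mulr0 mulr0.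
Qed.

(** For one test matrix [S] and one column [j], [pearson_mixture] kills the [g] part or the [h] part
    of row [k]. The remaining point is that the same part dies for all [S] and [j], which follows by
    comparing two such relations. *)
Lemma operator_rows_split (v : 'I_N -> {scalar {poly K}}) (phi psi : 'I_N -> {poly K})
    (P Pd : nat -> 'M[{poly K}]_N) (D : seq 'M[{poly K}]_N)
    (Wg Wh : 'M[{poly K}]_N) :
  (forall k, phi k != 0 /\ pearson_functional (v k) (phi k) (psi k)) ->
  (forall n, size_le n (P n - ('X^n)%:M)) ->
  (forall n m, n != m -> diag_pair v (P n) (Pd m) = 0) ->
  (forall n, diag_pair v (P n) (Pd n) \in unitmx) ->
  (forall S, exists M, forall n, (M <= n)%N ->
    map_mx g (act (P n) D *m Wg *m S) + map_mx h (act (P n) D *m Wh *m S) = 0) ->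
  forall k, (forall i p, act (p *: delta_mx i k) D *m Wg = 0) \/
            (forall i p, act (p *: delta_mx i k) D *m Wh = 0).
Proof.
move=> vP monP orth gram van k.
have /choice[A HA] : forall S, exists A : 'M[{poly K}]_N, forall P,
    map_mx g (act P D *m Wg *m S) = map_mx g (P *m A).
  by move=> S; have [A HA] := act_adjoint D (Wg *m S) gl; exists A => Q;
     rewrite -HA mulmxA.
have /choice[B HB] : forall S, exists A : 'M[{poly K}]_N, forall P,
    map_mx h (act P D *m Wh *m S) = map_mx h (P *m A).
  by move=> S; have [B HB] := act_adjoint D (Wh *m S) hl; exists B => Q;
     rewrite -HB mulmxA.
have entry u p i (T : 'M[{poly K}]_N) j :
    map_mx u (p *: delta_mx i k *m T) i j = u (p * T k j).
  rewrite !mxE (bigD1 k)//= big1 => [|m mk]; rewrite ?mxE ?eqxx ?mulr1 ?addr0//.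
  by rewrite (negPf mk) andbF mulr0 mul0r.
(* By [van], pairing with [S] kills [P n] for large [n], so it is represented by a polynomial
   matrix; its entry [(k, j)] is [q]. *)
have rep S j : exists q, forall p,
    v k (p * q) = g (p * A S k j) + h (p * B S k j).
  have [M vanM] := van S.
  pose L Q := map_mx g (Q *m A S) + map_mx h (Q *m B S).
  have [||n nM|T HT] := @diag_pair_represent v P Pd L M monP orth gram.
  - by move=> Q Q'; rewrite /L !mulmxDl !map_mxD addrACA.
  - by move=> X Q; rewrite /L -!mulmxA !map_functionalMl mulmxDr.
  - by rewrite /L -HA -HB vanM.
  exists (T k j) => p; have /matrixP/(_ k j) := HT (p *: delta_mx k k).
  rewrite /L [LHS]mxE !entry => ->; rewrite mxE (bigD1 k)//= big1 => [|m mk].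
    by rewrite !mxE !eqxx mulr1 addr0.
  by rewrite !mxE (negPf mk) andbF mulr0 mul0r raddf0.
have row0 u (T : 'M[{poly K}]_N -> 'M[{poly K}]_N) W :
    separating u -> (forall S P, map_mx u (act P D *m W *m S) = map_mx u (P *m T S)) ->
    (forall S j, T S k j = 0) -> forall i p, act (p *: delta_mx i k) D *m W = 0.
  move=> ndu HT T0 i p; apply: separating_mx ndu _ => S; rewrite HT.
  apply/matrixP => a j; rewrite !mxE big1 ?raddf0// => m _.
  have [->|mk] := eqVneq m k; first by rewrite T0 mulr0.
  by rewrite !mxE (negPf mk) andbF mulr0 mul0r.
have [A0|/existsNP[S /existsNP[j /eqP A1]]] := pselect (forall S j, A S k j = 0).
  by left; apply: (row0 g A).
right; apply: (row0 h B) => // S' j'; apply/eqP; apply: contraT => B1.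
(* Computing [v k (p * q1 * q2)] in two ways shows that the pairs [(A, B)] at [(S, j)] and
   [(S', j')] are proportional, with factors [q2] and [q1]. Hence both entries at [(S, j)] would be
   nonzero, against [pearson_mixture]. *)
have [q1 H1] := rep S j; have [q2 H2] := rep S' j'.
have [] := functionals_independent d0 gl hl ndg ndh
  (a := q2 * A S k j - q1 * A S' k j') (b := q2 * B S k j - q1 * B S' k j').
  move=> p; have E : v k (p * q2 * q1) = v k (p * q1 * q2) by congr (v k _); ring.
  move: E; rewrite H1 H2 !mulrBr !raddfB/= !mulrA => /eqP; rewrite -subr_eq0 => /eqP <-.
  ring.
move=> /eqP; rewrite subr_eq0 => /eqP EA /eqP; rewrite subr_eq0 => /eqP EB.
have q10 : q1 != 0.
  apply: contra_neq A1 => q10.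
  have [] // := functionals_independent d0 gl hl ndg ndh (a := A S k j) (b := B S k j).
  by move=> p; rewrite -H1 q10 mulr0 raddf0.
have B2 : B S k j != 0.
  apply: contra_eq_neq EB => ->; rewrite mulr0 eq_sym mulf_neq0//.
have [phi0 vk] := vP k.
have [/eqP|/eqP] := pearson_mixture d0 gl hl ndg ndh vk phi0 H1.
  by rewrite (negPf A1).
by rewrite (negPf B2).
Qed.

End MatrixPolynomials.

Lemma scalemx_inj0 (R : idomainType) m n (F : R) (Z : 'M[R]_(m, n)) :
  F != 0 -> F *: Z = 0 -> Z = 0.
Proof.
move=> F0 /matrixP FZ; apply/matrixP => i j; apply: (mulfI F0).
by have := FZ i j; rewrite !mxE mulr0.
Qed.

(** * Degrees and the leading coefficient *)

Section LeadingCoefficient.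
Variable K : fieldType.
Local Notation cmx X := (map_mx polyC X).
Local Notation act := (act (@deriv K)).

Lemma size_le_monic N n (P : 'M[{poly K}]_N) :
  size_le n (P - ('X^n)%:M) -> size_le n.+1 P.
Proof.
move=> hP; rewrite -[P](subrK ('X^n)%:M); apply: size_le_add.
  exact: size_le_trans hP.
move=> i j; rewrite mxE; case: (i == j); last by rewrite mulr0n size_poly0.
by rewrite mulr1n size_polyXn.
Qed.

Lemma coef_cmul_monic N n (X : 'M[K]_N) (Q : 'M[{poly K}]_N) i j :
  size_le n (Q - ('X^n)%:M) -> ((cmx X *m Q) i j)`_n = X i j.
Proof.
move=> monQ; have coefQ k : (Q k j)`_n = (k == j)%:R.
  have /leq_sizeP/(_ n (leqnn n)) := monQ k j.
  rewrite !mxE coefB => /eqP; rewrite subr_eq0 => /eqP ->.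
  by case: (k == j); rewrite ?mulr1n ?mulr0n ?coefXn ?eqxx ?coef0.
rewrite mxE coef_sum (bigD1 j)//= big1 => [|k kj].
  by rewrite mxE coefCM coefQ eqxx mulr1 addr0.
by rewrite mxE coefCM coefQ (negPf kj) mulr0.
Qed.

(** Any [T] is a left combination of the [P m], so divisibility by [F] spreads from the [P m] to all
    matrix polynomials, and the quotient keeps the size bound because [Q m] has the degree of
    [P m]. *)
Lemma act_divisible N (P Q : nat -> 'M[{poly K}]_N) (C : nat -> 'M[K]_N) D F :
  (forall n, size_le n (P n - ('X^n)%:M)) ->
  (forall n, size_le n (Q n - ('X^n)%:M)) ->
  (forall n, act (P n) D = F *: (cmx (C n) *m Q n)) ->
  forall n T, size_le n T -> exists2 Z, size_le n Z & act T D = F *: Z.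
Proof.
move=> monP monQ PD n T /(monic_span monP)[X ->].
exists (\sum_(m < n) cmx (X m) *m (cmx (C m) *m Q m)).
  elim/big_ind : _ => [i j|U V|m _]; [by rewrite mxE size_poly0|exact: size_le_add|].
  do 2!apply: size_le_cmul.
  exact: size_le_trans (ltn_ord m) (size_le_monic (monQ m)).
rewrite act_sum scaler_sumr; apply: eq_bigr => m _.
by rewrite act_cmul PD -scalemxAr.
Qed.

Definition Wgauss_row (a c : K) : 'rV[{poly K}]_3 :=
  \row_j nth 0 [:: a *: 'X; 1; c *: 'X] j.

(* The coefficient [Wh] of [e^(-x^2)] in the weight; that of [e^(-x^2+2bx)] is
   [delta_mx 0 0]. *)
Definition Wgauss (a c : K) : 'M[{poly K}]_3 :=
  (Wgauss_row a c)^T *m Wgauss_row a c + delta_mx ord_max ord_max.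

(* The left kernel of [Wgauss] is spanned by (1, - a x, 0). *)
Lemma Wgauss_kernel a c n (Z : 'M[{poly K}]_3) : a != 0 ->
  size_le n.+1 Z -> Z *m Wgauss a c = 0 -> forall i, (size (Z i 0)%R <= n)%N.
Proof.
move=> a0 hZ /matrixP ZW i; pose y := \sum_k Z i k * Wgauss_row a c 0 k.
have E j : y * Wgauss_row a c 0 j + Z i ord_max * (ord_max == j)%:R = 0.
  have := ZW i j; rewrite [in RHS]mxE => <-.
  rewrite mulmxDr mulmxA !mxE big_ord1 !mxE; congr (_ * _ + _).
    by apply: eq_bigr => k _; rewrite !mxE.
  rewrite (bigD1 ord_max)//= big1 => [|k km]; first by rewrite mxE !eqxx addr0 eq_sym.
  by rewrite mxE (negPf km) mulr0.
have y0 : y = 0.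
  by have := E (inord 1); rewrite !mxE -val_eqE /= !inordK//= mulr1 mulr0 addr0.
have Z2 : Z i ord_max = 0.
  by have := E ord_max; rewrite y0 mul0r add0r eqxx mulr1.
have : Z i (inord 1) = - (a *: (Z i 0 * 'X)).
  apply/eqP; rewrite -addr_eq0 -y0 /y 2!big_ord_recl big_ord1 !mxE /= mulr1.
  rewrite (_ : lift ord0 (lift _ _) = ord_max); last exact: val_inj.
  rewrite (_ : lift ord0 _ = inord 1); last by apply: val_inj; rewrite /= inordK.
  by rewrite Z2 mul0r addr0 addrC -scalerAr.
have [->|Z0] := eqVneq (Z i 0) 0; first by rewrite size_poly0.
(* The second entry is [- a x] times the first, so the bound [n.+1] on the second gives [n] on the
   first. *)
move=> /(congr1 (fun p : {poly K} => size p)); rewrite size_polyN size_scale// size_mulX// => E1.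
by rewrite -ltnS -E1.
Qed.

(** Cut [P n] into its single entries. Each piece is sent to [F] times a matrix of size at most
    [n.+1] in one of the two kernels, whose first column has size at most [n]. Summing, the first
    column of [C n Q n] has no term in ['X^n], and that coefficient is the first column of [C n]. *)
Lemma leading_column0 (a c : K) (P Q : nat -> 'M[{poly K}]_3) (C : nat -> 'M[K]_3) D
    (F : {poly K}) :
  a != 0 -> F != 0 ->
  (forall n, size_le n (P n - ('X^n)%:M)) ->
  (forall n, size_le n (Q n - ('X^n)%:M)) ->
  (forall n, act (P n) D = F *: (cmx (C n) *m Q n)) ->
  (forall k, (forall i p, act (p *: delta_mx i k) D *m (delta_mx 0 0 : 'M[{poly K}]_3) = 0) \/
             (forall i p, act (p *: delta_mx i k) D *m Wgauss a c = 0)) ->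
  forall n i, C n i 0 = 0.
Proof.
move=> a0 F0 monP monQ PD split n i.
have small i' k : exists2 z : {poly K}, (size z <= n)%N &
    act (P n i' k *: delta_mx i' k) D i 0 = F * z.
  have [|Z hZ EZ] := act_divisible monP monQ PD (n := n.+1) (T := P n i' k *: delta_mx i' k).
    move=> s t; rewrite !mxE; case: (_ && _); last by rewrite mulr0 size_poly0.
    by rewrite mulr1; apply: size_le_monic.
  exists (Z i 0); last by rewrite EZ mxE.
  have [/(_ i' (P n i' k))|/(_ i' (P n i' k))] := split k;
    rewrite EZ -scalemxAl => /(scalemx_inj0 F0) ZW.
    have /matrixP/(_ i 0) := ZW; rewrite !mxE (bigD1 0)//= big1 => [|m m0].
      by rewrite mxE !eqxx mulr1 addr0 => ->; rewrite size_poly0.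
    by rewrite mxE (negPf m0) mulr0.
  exact: Wgauss_kernel a0 hZ ZW _.
have : (size ((cmx (C n) *m Q n) i 0)%R <= n)%N.
  have /choice[z Hz] : forall ik : 'I_3 * 'I_3, exists z : {poly K}, (size z <= n)%N /\
      act (P n ik.1 ik.2 *: delta_mx ik.1 ik.2) D i 0 = F * z.
    by case=> i' k; have [z] := small i' k; exists z.
  have -> : (cmx (C n) *m Q n) i 0 = \sum_i' \sum_k z (i', k).
    apply: (mulfI F0).
    transitivity (act (P n) D i 0); first by rewrite PD [RHS]mxE.
    rewrite {1}[P n]matrix_sum_delta act_sum summxE mulr_sumr; apply: eq_bigr => i' _.
    rewrite act_sum summxE mulr_sumr; apply: eq_bigr => k _.
    by have [_ /= ->] := Hz (i', k).
  apply: leq_trans (size_sum _ _ _) _; apply/bigmax_leqP => i' _.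
  apply: leq_trans (size_sum _ _ _) _; apply/bigmax_leqP => k _.
  by have [] := Hz (i', k).
by move=> /leq_sizeP/(_ n (leqnn n)); rewrite coef_cmul_monic.
Qed.

End LeadingCoefficient.

(** * Integration against a weight as a functional on complex polynomials *)

Section Moments.
Variable R : realType.
Local Notation mu := (@lebesgue_measure R).
Implicit Type w : R -> R.

Definition moments_integrable w :=
  forall n, mu.-integrable setT (EFin \o (fun x => x ^+ n * w x)).

Lemma poly_integrable w (p : {poly R}) : moments_integrable w ->
  mu.-integrable setT (EFin \o (fun x => p.[x] * w x)).
Proof.
move=> iw; rewrite (_ : EFin \o _ =
    (fun x => \sum_(k <- iota 0 (size p)) (p`_k)%:E * (x ^+ k * w x)%:E)%E).
  apply: integrable_sum => // k _.
  exact/(integrableZl measurableT (p`_k))/(iw k).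
apply/funext => x /=; rewrite sumEFin horner_coef mulr_suml.
rewrite -(big_mkord xpredT (fun k => p`_k * x ^+ k * w x)) /index_iota subn0.
by congr (_%:E); apply: eq_bigr => k _; rewrite mulrA.
Qed.

Definition moment w n := \int[mu]_(x in setT) (x ^+ n * w x).

Definition cintegrable (f : R -> R[i]) :=
  mu.-integrable setT (EFin \o (fun x => complex.Re (f x))) /\
  mu.-integrable setT (EFin \o (fun x => complex.Im (f x))).

Lemma cintegrableD f g : cintegrable f -> cintegrable g ->
  cintegrable (fun x => f x + g x).
Proof.
move=> [f1 f2] [g1 g2]; split.
  rewrite (_ : EFin \o _ = (fun x => (complex.Re (f x))%:E + (complex.Re (g x))%:E)%E).
    exact: integrableD.
  by apply/funext => x /=; case: (f x) => ? ?; case: (g x).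
rewrite (_ : EFin \o _ = (fun x => (complex.Im (f x))%:E + (complex.Im (g x))%:E)%E).
  exact: integrableD.
by apply/funext => x /=; case: (f x) => ? ?; case: (g x).
Qed.

Lemma cintegralD f g : cintegrable f -> cintegrable g ->
  cintegral setT (fun x => f x + g x) = cintegral setT f + cintegral setT g.
Proof.
move=> [f1 f2] [g1 g2]; rewrite /cintegral.
transitivity ((\int[mu]_(x in setT) (complex.Re (f x) + complex.Re (g x)))
  +i* (\int[mu]_(x in setT) (complex.Im (f x) + complex.Im (g x)))).
  by congr (_ +i* _); apply: eq_Rintegral => x _; case: (f x) => ? ?; case: (g x).
by rewrite !RintegralD.
Qed.

Lemma cintegrable0 : cintegrable (fun=> 0 : R[i]).
Proof. by split; exact: integrable0. Qed.

Lemma cintegral0 : cintegral setT (fun=> 0) = 0 :> R[i].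
Proof.
rewrite /cintegral /Rintegral /=.
by rewrite !integral0.
Qed.

Lemma cintegral_sum (I : Type) (r : seq I) (f : I -> R -> R[i]) :
  (forall i, cintegrable (f i)) ->
  cintegral setT (fun x => \sum_(i <- r) f i x) = \sum_(i <- r) cintegral setT (f i) /\
  cintegrable (fun x => \sum_(i <- r) f i x).
Proof.
move=> fI; elim: r => [|i r [IH1 IH2]].
  under eq_fun do rewrite big_nil; rewrite big_nil cintegral0; split=> //.
  exact: cintegrable0.
under eq_fun do rewrite big_cons; rewrite big_cons; split.
  by rewrite cintegralD// IH1.
exact: cintegrableD.
Qed.

Lemma cintegralZ (c : R[i]) (f : R -> R) :
  mu.-integrable setT (EFin \o f) ->
  cintegral setT (fun x => c * (f x)%:C) = c * (\int[mu]_(x in setT) f x)%:C /\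
  cintegrable (fun x => c * (f x)%:C).
Proof.
move=> fI; case: c => a b.
have Re_E x : complex.Re ((a +i* b) * (f x)%:C) = a * f x by rewrite /= mulr0 subr0.
have Im_E x : complex.Im ((a +i* b) * (f x)%:C) = b * f x by rewrite /= mulr0 add0r.
split; last first.
  have iZ k : mu.-integrable setT (EFin \o (fun x => k * f x)).
    exact: (integrableZl measurableT k fI).
  split; [have := iZ a | have := iZ b]; congr (mu.-integrable setT (EFin \o _));
    by apply/funext => x; rewrite ?Re_E ?Im_E.
rewrite /cintegral; under eq_Rintegral do rewrite Re_E.
under [X in _ +i* X]eq_Rintegral do rewrite Im_E.
rewrite !RintegralZl//.
by rewrite /GRing.mul/= !mulr0 subr0 add0r.
Qed.

(** Defined through the moments rather than as an integral, so that linearity in [p] needs no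
    integrability; [cintegral_mom] identifies it with the integral. *)
Definition mom w (p : {poly R[i]}) : R[i] := \sum_(k < size p) p`_k * (moment w k)%:C.

Lemma mom_wide w (p : {poly R[i]}) n : (size p <= n)%N ->
  mom w p = \sum_(k < n) p`_k * (moment w k)%:C.
Proof.
move=> pn; rewrite /mom (big_ord_widen _ (fun k => p`_k * (moment w k)%:C) pn).
rewrite big_mkcond; apply: eq_bigr => k _; case: ltnP => // kp.
by rewrite nth_default// mul0r.
Qed.

Lemma mom_is_scalar w : scalar (mom w).
Proof.
move=> a p q; pose n := maxn (size p) (size q).
rewrite (@mom_wide _ (a *: p + q) n); last first.
  apply: leq_trans (size_polyD _ _) _; rewrite geq_max leq_maxr andbT.
  exact: leq_trans (size_scale_leq _ _) (leq_maxl _ _).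
rewrite (@mom_wide _ p n) ?leq_maxl// (@mom_wide _ q n) ?leq_maxr//.
rewrite mulr_sumr -big_split/=; apply: eq_bigr => k _.
by rewrite coefD coefZ mulrDl mulrA.
Qed.

HB.instance Definition _ w :=
  GRing.isLinear.Build _ _ _ _ (mom w) (mom_is_scalar w).

Lemma cintegral_mom w (p : {poly R[i]}) : moments_integrable w ->
  cintegral setT (fun x => p.[x%:C] * (w x)%:C) = mom w p /\
  cintegrable (fun x => p.[x%:C] * (w x)%:C).
Proof.
move=> iw; have E x : p.[x%:C] * (w x)%:C =
    \sum_(k < size p) p`_k * (x ^+ k * w x)%:C.
  rewrite horner_coef mulr_suml; apply: eq_bigr => k _.
  by rewrite rmorphM rmorphXn mulrA.
under eq_fun do rewrite E.
have [|-> ?] := @cintegral_sum _ (index_enum 'I_(size p))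
  (fun k x => p`_k * (x ^+ k * w x)%:C) ; last first.
  by split=> //; apply: eq_bigr => k _; have [->] := cintegralZ p`_k (iw k).
by move=> k; have [] := cintegralZ p`_k (iw k).
Qed.

Lemma mom_real w (p : {poly R}) : moments_integrable w ->
  mom w (map_poly (real_complex R) p) = (\int[mu]_(x in setT) (p.[x] * w x))%:C.
Proof.
move=> iw; have [<- _] := cintegral_mom (map_poly (real_complex R) p) iw.
have E x : (map_poly (real_complex R) p).[x%:C] * (w x)%:C = 1 * (p.[x] * w x)%:C.
  by rewrite (horner_map (real_complex R)) mul1r rmorphM.
under eq_fun do rewrite E.
by have [-> _] := cintegralZ 1 (poly_integrable p iw); rewrite mul1r.
Qed.

End Moments.

(** * Integration by parts on the whole line *)

Section IntegrationByParts.
Variable R : realType.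
Local Notation mu := (@lebesgue_measure R).
Implicit Types (f F w : R -> R) (p phi psi : {poly R}).

(** Dominated convergence, with [|f|] as dominating function; at each point the truncations are
    eventually equal to [f]. *)
Lemma cvg_integral_segment f : mu.-integrable setT (EFin \o f) ->
  (\int[mu]_(x in `[- n%:R, n%:R]) f x) @[n --> \oo] --> \int[mu]_(x in setT) f x.
Proof.
move=> fi.
have mf : measurable_fun setT f.
  by apply/measurable_EFinP; exact: (measurable_int _ fi).
pose f_ n x := (EFin \o (f \_ (`[- n%:R, n%:R]%classic : set R))) x.
have [|||||_ _ cv] := @dominated_convergence _ _ R mu setT measurableT f_ (EFin \o f)
    (fun x => `|(f x)%:E|)%E.
- move=> n; apply/measurable_EFinP.
  apply: (measurable_restrictT f _).1 => //.
  by apply: measurable_funS mf.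
- exact: measurable_int _ fi.
- apply: aeW => x _; apply: cvg_near_cst.
  near=> n; rewrite /f_/= patchE ifT// inE/= in_itv/= -ler_norml.
  by near: n; exact: nbhs_infty_ger.
- exact: integrable_abse.
- apply: aeW => x n _; rewrite /f_ /= patchE; case: ifP => // _.
  by rewrite normr0 lee_fin.
have -> : (fun n => \int[mu]_(x in `[- n%:R, n%:R]) f x) =
    (fun n => fine (\int[mu]_x f_ n x)%E).
  by apply/funext => n; rewrite Rintegral_mkcond.
suff /fine_cvgP[] : (\int[mu]_x f_ n x)%E @[n --> \oo] --> (\int[mu]_(x in setT) f x)%:E by [].
rewrite fineK//; exact: integrable_fin_num.
Unshelve. all: end_near. Qed.

Lemma integral_segment_derive F f n : (forall x : R, is_derive x 1 F (f x)) ->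
  continuous f -> \int[mu]_(x in `[- n%:R, n%:R]) f x = F n%:R - F (- n%:R).
Proof.
move=> dF cf; case: n => [|n].
  by rewrite oppr0 subrr set_itv1 Rintegral_set1.
have cF : continuous F.
  by move=> x; apply: differentiable_continuous; apply/derivable1_diffP;
     have [] := dF x.
rewrite /Rintegral (@continuous_FTC2 _ f F)//.
- by rewrite gtrN ?ltr0n.
- exact: continuous_subspaceT.
- split; first by move=> x _; have [] := dF x.
  + exact/cvg_at_right_filter/cF.
  + exact/cvg_at_left_filter/cF.
- by move=> x _; rewrite derive1E; have [] := dF x.
Qed.

(** The derivative is required at every real point, including end points of the support, where [phi]
    must therefore compensate the singularities of [w]. Continuity serves the fundamental theorem of
    calculus. *)
Definition pearson_weight w phi psi :=
  (forall x : R, is_derive x 1 (fun x => phi.[x] * w x) (psi.[x] * w x)) /\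
  continuous (fun x => psi.[x] * w x).

(* The boundary terms vanish: they converge, and multiplying p by 'X^2 shows
   that they still converge after multiplication by n ^ 2. *)
Lemma pearson_integral w phi psi p : pearson_weight w phi psi ->
  moments_integrable w ->
  \int[mu]_(x in setT) ((phi * p^`() + psi * p).[x] * w x) = 0.
Proof.
move=> [dw cw] iw; pose G p x := (phi * p^`() + psi * p).[x] * w x.
pose F p x := p.[x] * (phi.[x] * w x).
have dF q (x : R) : is_derive x 1 (F q) (G q x).
  have := @is_deriveM _ _ (horner q) (fun x => phi.[x] * w x) x 1 _ _
    (is_derive_poly q x) (dw x).
  move=> /is_derive_eq; apply; rewrite /G hornerD !hornerM /GRing.scale/=.
  ring.
have cw1 : continuous (fun x => phi.[x] * w x).
  by move=> x; apply: differentiable_continuous; apply/derivable1_diffP;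
     have [] := dw x.
have cG q : continuous (G q).
  have -> : G q = (fun x => q^`().[x] * (phi.[x] * w x) + q.[x] * (psi.[x] * w x)).
    by apply/funext => x; rewrite /G hornerD !hornerM; ring.
  move=> x; apply: cvgD; apply: cvgM; by [exact: continuous_horner|exact: cw|exact: cw1].
have cv q : (F q n%:R - F q (- n%:R)) @[n --> \oo] --> \int[mu]_(x in setT) G q x.
  have := cvg_integral_segment (poly_integrable (phi * q^`() + psi * q) iw).
  by under eq_fun do rewrite (integral_segment_derive _ (dF q) (cG q)).
rewrite -[LHS](cvg_lim _ (cv p))//; apply/cvg_lim => //.
have H2 := cv (p * 'X^2).
have inv : n%:R^-1 @[n --> \oo] --> (0 : R).
  by rewrite -(cvg_shiftS (fun n => n%:R^-1 : R)); exact: cvg_harmonic.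
have inv0 : (n%:R ^+ 2)^-1 @[n --> \oo] --> (0 : R).
  have -> : (fun n => (n%:R ^+ 2)^-1 : R) = (fun n => n%:R^-1 * n%:R^-1).
    by apply/funext => n; rewrite expr2 invfM.
  rewrite -[X in _ --> X](mulr0 (0 : R)); apply: cvgM; exact: inv.
have -> : (fun n => F p n%:R - F p (- n%:R)) =
    (fun n => (n%:R ^+ 2)^-1 * (F (p * 'X^2) n%:R - F (p * 'X^2) (- n%:R))).
  (* At [n = 0] the two boundary terms coincide, so the inverse of zero is harmless. *)
  apply/funext => -[|n]; first by rewrite oppr0 !subrr mulr0.
  rewrite /F !hornerM !hornerX; field.
  by rewrite nat1r pnatr_eq0.
rewrite -[X in _ --> X](mul0r (\int[mu]_(x in setT) G (p * 'X^2) x)).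
by apply: cvgM; [exact: inv0|exact: H2].
Qed.

(** Expanding [p] in monomials reduces complex test polynomials to the real identity
    [pearson_integral]. *)
Lemma mom_pearson w phi psi : pearson_weight w phi psi -> moments_integrable w ->
  pearson_functional (mom w) (map_poly (real_complex R) phi) (map_poly (real_complex R) psi).
Proof.
move=> wP iw p; rewrite -[p]coefK poly_def raddf_sum/=.
rewrite !mulr_sumr -big_split raddf_sum big1//= => i _.
have -> : map_poly (real_complex R) phi * (p`_i *: 'X^i)^`() +
    map_poly (real_complex R) psi * (p`_i *: 'X^i) =
    p`_i *: map_poly (real_complex R) (phi * 'X^i^`() + psi * 'X^i).
  by rewrite derivZ rmorphD !rmorphM/= -deriv_map map_polyXn -!scalerAr -scalerDr.
by rewrite scalarZ /= mom_real// pearson_integral// mulr0.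
Qed.

Lemma mom_norm w p q : moments_integrable w ->
  mom w ((map_poly (real_complex R) p + 'i%C *: map_poly (real_complex R) q)
    * (map_poly (real_complex R) p - 'i%C *: map_poly (real_complex R) q)) =
  (\int[mu]_(x in setT) ((p ^+ 2 + q ^+ 2).[x] * w x))%:C.
Proof.
move=> iw; rewrite -mom_real//; congr (mom w _).
rewrite rmorphD !rmorphXn/= -!mul_polyC.
set P := map_poly _ p; set Q := map_poly _ q.
transitivity (P ^+ 2 - ('i%C ^+ 2)%:P * Q ^+ 2); first by rewrite rmorphXn/=; ring.
by rewrite sqr_i polyCN mulN1r opprK.
Qed.

End IntegrationByParts.

(** * Positivity of the moment functionals *)

Section Positivity.
Variable R : realType.
Local Notation mu := (@lebesgue_measure R).
Implicit Types (w : R -> R).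
Local Notation rpoly := (map_poly (real_complex R)).

Definition conjp (p : {poly R[i]}) : {poly R[i]} := map_poly Num.conj p.

(** Classical weights may vanish outside an interval; positivity on one interval suffices, as a
    nonzero polynomial has finitely many roots. *)
Definition positive_weight w :=
  (forall x, 0 <= w x) /\ exists a b, a < b /\ forall x, a < x < b -> 0 < w x.

Lemma poly_ReIm (p : {poly R[i]}) : exists q r : {poly R},
  p = rpoly q + 'i%C *: rpoly r /\ conjp p = rpoly q - 'i%C *: rpoly r.
Proof.
exists (map_poly (@complex.Re R) p), (map_poly (@complex.Im R) p).
split; apply/polyP => k; rewrite /conjp ?coefB ?coefD coefZ !coef_map/=.
  by case: (p`_k) => a b; apply/eqP; rewrite eq_complex/= ; apply/andP; split; apply/eqP; ring.
by case: (p`_k) => a b; apply/eqP; rewrite eq_complex/= ; apply/andP; split; apply/eqP; ring.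
Qed.

Lemma poly_roots_finite (p : {poly R}) : p != 0 -> finite_set [set x | root p x].
Proof.
move=> p0; apply: contrapT => /(infinite_set_fset (size p))[B BA].
rewrite leqNgt => /negP; apply; apply: max_poly_roots => //.
  by apply/allP => x xB; exact: BA xB.
exact: finmap.fset_uniq.
Qed.

(** A nonnegative integrand with integral zero vanishes almost everywhere, so for [p != 0] an
    interval of positive length would be covered by a null set and the finite set of roots of
    [p]. *)
Lemma integral_poly_eq0 w (p : {poly R}) : moments_integrable w ->
  positive_weight w -> (forall x, 0 <= p.[x]) ->
  \int[mu]_(x in setT) (p.[x] * w x) = 0 -> p = 0.
Proof.
move=> iw [w0 [a [b [ab wab]]]] p_ge0 I0; apply/eqP/negPn/negP => p0.
have ip := poly_integrable p iw.
have : ae_eq mu setT (fun x => (p.[x] * w x)%:E) (cst 0%E).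
  apply/(ae_eq_integral_abs mu measurableT (measurable_int _ ip)).
  have : (\int[mu]_x (p.[x] * w x)%:E = 0)%E.
    have /fineK := integrable_fin_num measurableT ip.
    by rewrite [X in X%:E]I0 => <-.
  move=> E; rewrite -[RHS]E; apply: eq_integral => x _ /=.
  by rewrite ger0_norm// mulr_ge0.
move=> [N [mN N0 sub]].
have mroots : measurable ([set x | root p x] : set (measurableTypeR R)).
  apply: countable_measurable => //.
  exact/finite_set_countable/poly_roots_finite.
have roots0 : mu [set x | root p x] = 0%E.
  exact/countable_lebesgue_measure0/finite_set_countable/poly_roots_finite.
have : (mu `]a, b[ <= mu (N `|` [set x | root p x]))%E.
  apply: le_measure; rewrite ?inE//.
    exact: measurableU.
  move=> x; rewrite /= in_itv/= => xab.
  have [rx|rx] := boolP (root p x); first by right.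
  left; apply: sub => /= /(_ I) /eqP; rewrite eqe mulf_eq0 -rootE (negPf rx)/=.
  by rewrite gt_eqF// wab.
rewrite lebesgue_measure_itv/= lte_fin ab; apply/negP; rewrite -ltNge.
apply: le_lt_trans (measureU2 _ mN mroots) _.
by rewrite [X in (X + _)%E]N0 [X in (_ + X)%E]roots0 adde0 lte_fin subr_gt0.
Qed.

Lemma mom_conj_ge0 w p : moments_integrable w -> positive_weight w ->
  0 <= mom w (p * conjp p).
Proof.
move=> iw [w0 _]; have [q [r [-> ->]]] := poly_ReIm p.
rewrite mom_norm// lecR Rintegral_ge0// => x _.
by rewrite mulr_ge0// hornerD !horner_exp addr_ge0// sqr_ge0.
Qed.

Lemma mom_conj_eq0 w p : moments_integrable w -> positive_weight w ->
  mom w (p * conjp p) = 0 -> p = 0.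
Proof.
move=> iw w0; have [q [r [-> ->]]] := poly_ReIm p.
rewrite mom_norm// => -[I0].
have qr_ge0 x : 0 <= (q ^+ 2 + r ^+ 2).[x].
  by rewrite hornerD !horner_exp addr_ge0// sqr_ge0.
have qr0 : q ^+ 2 + r ^+ 2 = 0 by exact: integral_poly_eq0 I0.
(* If [s] were nonzero, some natural number would not be a root of it, and there the sum of squares
   would be positive. *)
have z (s t : {poly R}) : s ^+ 2 + t ^+ 2 = 0 -> s = 0.
  move=> st; apply/eqP; apply: contraT => s0.
  have [x] : exists x, ~~ root s x.
    apply: contrapT => /forallNP H.
    have /infinite_nat : finite_set [set: nat].
      apply: (@sub_finite_set _ _ ((fun n => n%:R : R) @^-1` [set x | root s x])).
        by move=> n _ /=; apply/negPn/negP/H.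
      apply: finite_preimage (poly_roots_finite s0).
      by move=> m n _ _ /eqP; rewrite eqr_nat => /eqP.
    by [].
  have /(congr1 (horner^~ x)) := st; rewrite hornerD !horner_exp horner0 rootE.
  move=> /eqP; rewrite paddr_eq0 ?sqr_ge0// sqrf_eq0 => /andP[-> _].
  by [].
by rewrite (z _ _ qr0) (z r q) 1?addrC// rmorph0 scaler0 addr0.
Qed.

Lemma mom_separating w : moments_integrable w -> positive_weight w ->
  separating (mom w).
Proof.
move=> iw w0 q H; apply: mom_conj_eq0 => //.
by rewrite mulrC H.
Qed.

End Positivity.

(** * Pearson equations of the classical weights *)

Section PearsonWeights.
Variable R : realType.
Implicit Types (a k s t x y : R) (w : R -> R).

Lemma is_derive_continuous (f df : R -> R) :
  (forall x : R, is_derive x 1 f (df x)) -> continuous f.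
Proof.
by move=> d x; apply: differentiable_continuous; apply/derivable1_diffP;
   have [] := d x.
Qed.

Let horner1 x : (1 : {poly R}).[x] = 1. Proof. exact: hornerC. Qed.

Let hE := (hornerM, hornerD, hornerN, hornerZ, hornerX, horner_exp, horner1, hornerC).

(** Extension by zero to the nonpositive half line, which is differentiable everywhere, also at 0,
    once the exponent is at least 2. *)
Definition pos_power a y := if 0 < y then y `^ a else 0.

Lemma pos_power_gt0 a y : 0 < y -> pos_power a y = y `^ a.
Proof. by rewrite /pos_power => ->. Qed.

Lemma pos_power_le0 a y : y <= 0 -> pos_power a y = 0.
Proof. by rewrite /pos_power leNgt; case: ifP. Qed.

Lemma pos_powerM a y : y * pos_power a y = pos_power (a + 1) y.
Proof.
have [y0|y0] := ltP 0 y; last by rewrite !pos_power_le0// mulr0.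
rewrite !pos_power_gt0// powRD; last by rewrite (gt_eqF y0) implybT.
by rewrite powRr1 ?ltW// mulrC.
Qed.

Lemma pos_power_small a y : 1 <= a -> `|y| <= 1 -> `|pos_power a y| <= `|y|.
Proof.
move=> a1 y1; have [y0|y0] := ltP 0 y; last by rewrite pos_power_le0// normr0.
rewrite pos_power_gt0// ger0_norm ?powR_ge0// gtr0_norm//.
by rewrite gtr0_norm// in y1; apply: ge1r_powR; rewrite ?y0.
Qed.

(** Only 0 is delicate: there the difference quotient is [pos_power (a - 1)], bounded by [|h|] near
    0 because [a - 1 >= 1]. *)
Lemma pos_power_derive a y : 2 <= a ->
  is_derive y 1 (pos_power a) (a * pos_power (a - 1) y).
Proof.
move=> a2; have [y0|y0|->] := ltrgt0P y.
- rewrite pos_power_gt0//.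
  apply: near_eq_is_derive (is_derive1_powR a y0).
  near=> z; rewrite pos_power_gt0//; near: z; exact: lt_nbhsr.
- rewrite pos_power_le0 ?ltW// mulr0.
  apply: near_eq_is_derive (is_derive_cst 0 y 1).
  near=> z; rewrite pos_power_le0//= ltW//; near: z; exact: lt_nbhsl.
rewrite [X in a * X]pos_power_le0// mulr0.
have cv : h^-1 *: (pos_power a (h *: 1 + 0) - pos_power a 0) @[h --> 0^'] --> (0 : R).
  have -> : (fun h : R => h^-1 *: (pos_power a (h *: 1 + 0) - pos_power a 0)) =
      pos_power (a - 1).
    apply/funext => h; rewrite (@pos_power_le0 a 0)// subr0 addr0 /GRing.scale/= mulr1.
    have [->|h0] := eqVneq h 0; first by rewrite !pos_power_le0// mulr0.
    by rewrite -{1}[a](subrK 1) -pos_powerM mulKf.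
  have a11 : 1 <= a - 1 by rewrite lerBrDr.
  apply/norm_cvg0P; apply: (squeeze_cvgr (f := fun=> 0) (h := fun h => `|h|)).
  - near=> h; rewrite normr_ge0 pos_power_small//.
    near: h; apply: nbhs_dnbhs; apply/nbhs_normP; exists 1 => //= z.
    by rewrite /ball_/= sub0r normrN => /ltW.
  - exact: cvg_cst.
  - rewrite -[X in _ --> X](@normr0 _ R); apply: cvg_norm; apply: cvg_within_filter; exact: cvg_id.
apply: DeriveDef; last exact/cvg_lim.
by apply/cvg_ex; exists 0.
Unshelve. all: end_near. Qed.

Lemma pos_power_continuous a : 2 <= a -> continuous (pos_power a).
Proof. by move=> a2; apply: is_derive_continuous => y; exact: pos_power_derive. Qed.

Lemma continuous_affine s t : continuous (fun x => s * x + t).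
Proof.
by move=> x; apply: cvgD; [apply: cvgM; [exact: cvg_cst|exact: cvg_id]|exact: cvg_cst].
Qed.

Lemma is_derive_affine s t x : is_derive x 1 (fun x => s * x + t) s.
Proof.
have -> : (fun x => s * x + t) = horner (s *: 'X + t%:P).
  by apply/funext => y; rewrite !hornerE.
apply: is_derive_eq.
by rewrite derivD derivZ derivX derivC addr0 hornerZ hornerC mulr1.
Qed.

Lemma continuous_expoly (p : {poly R}) : continuous (fun x => expR p.[x]).
Proof.
move=> x; apply: (continuous_comp (f := horner p)); first exact: continuous_horner.
exact: continuous_expR.
Qed.

Lemma is_derive_expoly (p : {poly R}) x :
  is_derive x 1 (fun x => expR p.[x]) (p^`().[x] * expR p.[x]).
Proof.
have := is_derive1_comp (is_derive_expR p.[x]) (is_derive_poly p x).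
by rewrite mulrC.
Qed.

Lemma pearson_expoly (p : {poly R}) : pearson_weight (fun x => expR p.[x]) 1 p^`().
Proof.
split=> x.
  have -> : (fun x => (1 : {poly R}).[x] * expR p.[x]) = (fun x => expR p.[x]).
    by apply/funext => y; rewrite hornerC mul1r.
  exact: is_derive_expoly.
by apply: cvgM; [exact: continuous_horner|exact: continuous_expoly].
Qed.

Lemma pos_powerXn a n y : y ^+ n * pos_power a y = pos_power (a + n%:R) y.
Proof.
elim: n => [|n IH]; first by rewrite mul1r addr0.
by rewrite exprS -mulrA IH pos_powerM -addrA natr1.
Qed.

(** The usual [phi = x] would leave [x^(a+1)], which need not be differentiable at 0. With [x^4] the
    exponents [a + 4] of [phi w] and [a + 3] of its derivative both exceed 2. *)
Lemma pearson_laguerre a : -1 < a ->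
  pearson_weight (fun x => if 0 < x then x `^ a * expR (- x) else 0)
    ('X ^+ 4) ((a + 4) *: 'X ^+ 3 - 'X ^+ 4).
Proof.
move=> a1; set w := (fun x => if _ then _ else _).
have wE x : w x = pos_power a x * expR (- 'X).[x].
  rewrite /w /pos_power hornerN hornerX.
  by case: ifP => // _; rewrite mul0r.
have a4 : 2 <= a + 4 by lra.
have a3 : 2 <= a + 3 by lra.
have F x : ((a + 4) *: 'X ^+ 3 - 'X ^+ 4).[x] * w x =
  ((a + 4) * pos_power (a + 3) x - pos_power (a + 4) x) * expR (- 'X).[x].
  rewrite wE -!pos_powerXn hornerD !hornerN hornerZ !hornerXn; ring.
split=> [x|].
  have -> : (fun x => ('X ^+ 4).[x] * w x) =
      pos_power (a + 4) * (fun x => expR (- 'X).[x]).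
    by apply/funext => y; rewrite wE hornerXn mulrA pos_powerXn.
  apply: is_derive_eq (is_deriveM (pos_power_derive x a4) (is_derive_expoly (- 'X) x)) _.
  rewrite F derivN derivX !hornerN hornerC /GRing.scale/=.
  rewrite (_ : a + 4 - 1 = a + 3); last by ring.
  ring.
have -> : (fun x => ((a + 4) *: 'X ^+ 3 - 'X ^+ 4).[x] * w x) =
    (fun x => ((a + 4) * pos_power (a + 3) x - pos_power (a + 4) x) * expR (- 'X).[x]).
  by apply/funext => x; exact: F.
move=> x; apply: cvgM; last exact: continuous_expoly.
apply: cvgB; last exact: pos_power_continuous.
by apply: cvgM; [exact: cvg_cst|exact: pos_power_continuous].
Qed.

(** Fourth powers at both end points play the same role as in the Laguerre case. Writing [w] as a
    product of two truncated powers of affine functions removes the case distinction on the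
    support. *)
Lemma pearson_jacobi a b : -1 < a -> -1 < b ->
  pearson_weight (fun x => if -1 < x < 1 then (1 - x) `^ a * (1 + x) `^ b else 0)
    ((1 - 'X) ^+ 4 * (1 + 'X) ^+ 4)
    (((b + 4) *: (1 - 'X) - (a + 4) *: (1 + 'X)) * ((1 - 'X) ^+ 3 * (1 + 'X) ^+ 3)).
Proof.
move=> a1 b1; set w := (fun x => if _ then _ else _).
have wE x : w x = pos_power a (- 1 * x + 1) * pos_power b (1 * x + 1).
  rewrite mulN1r mul1r [- x + 1]addrC [x + 1]addrC.
  rewrite /w /pos_power subr_gt0 -ltrBlDl sub0r.
  by case: (-1 < x); case: (x < 1); rewrite /= ?mul0r ?mulr0.
have a4 : 2 <= a + 4 by lra.
have a3 : 2 <= a + 3 by lra.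
have b4 : 2 <= b + 4 by lra.
have b3 : 2 <= b + 3 by lra.
pose G x := (b + 4) * (pos_power (a + 4) (- 1 * x + 1) * pos_power (b + 3) (1 * x + 1))
  - (a + 4) * (pos_power (a + 3) (- 1 * x + 1) * pos_power (b + 4) (1 * x + 1)).
have F x : (((b + 4) *: (1 - 'X) - (a + 4) *: (1 + 'X)) *
    ((1 - 'X) ^+ 3 * (1 + 'X) ^+ 3)).[x] * w x = G x.
  rewrite wE /G -!pos_powerXn !hE; ring.
split=> [x|].
  have -> : (fun x => ((1 - 'X) ^+ 4 * (1 + 'X) ^+ 4).[x] * w x) =
      (pos_power (a + 4) \o (fun x => - 1 * x + 1)) * (pos_power (b + 4) \o (fun x => 1 * x + 1)).
    apply/funext => y.
    transitivity (pos_power (a + 4) (- 1 * y + 1) * pos_power (b + 4) (1 * y + 1)); last by [].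
    by rewrite wE -!pos_powerXn !hE; ring.
  apply: is_derive_eq (is_deriveM
    (is_derive1_comp (pos_power_derive _ a4) (is_derive_affine (- 1) 1 x))
    (is_derive1_comp (pos_power_derive _ b4) (is_derive_affine 1 1 x))) _.
  rewrite F /G /GRing.scale/=.
  rewrite (_ : a + 4 - 1 = a + 3); last by ring.
  rewrite (_ : b + 4 - 1 = b + 3); last by ring.
  ring.
rewrite (_ : (fun x => _) = G); last by apply/funext => x; exact: F.
have c s e x : 2 <= e -> pos_power e (s * y + 1) @[y --> x] --> pos_power e (s * x + 1).
  move=> e2; apply: (continuous_comp (f := fun y => s * y + 1)); first exact: continuous_affine.
  exact: pos_power_continuous.
move=> x; apply: cvgB; (apply: cvgM; first exact: cvg_cst); by apply: cvgM; apply: c.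
Qed.

Lemma pearson_affine w phi psi k s t : pearson_weight w phi psi ->
  pearson_weight (fun x => k * w (s * x + t))
    (phi \Po (s *: 'X + t%:P)) (s *: (psi \Po (s *: 'X + t%:P))).
Proof.
move=> [dw cw]; split=> [x|].
  have -> : (fun x => (phi \Po (s *: 'X + t%:P)).[x] * (k * w (s * x + t))) =
     k *: ((fun x => phi.[x] * w x) \o (fun x => s * x + t)).
    apply/funext => y; transitivity (k * (phi.[s * y + t] * w (s * y + t))); last by [].
    by rewrite horner_comp !hE; ring.
  apply: is_derive_eq (is_deriveZ _ (is_derive1_comp (dw _) (is_derive_affine s t x))) _.
  rewrite /GRing.scale/= hornerZ horner_comp !hE; ring.
have -> : (fun x => (s *: (psi \Po (s *: 'X + t%:P))).[x] * (k * w (s * x + t))) =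
    (fun x => (s * k) * (psi.[s * x + t] * w (s * x + t))).
  apply/funext => y; rewrite hornerZ horner_comp !hE; ring.
move=> x; apply: cvgM; first exact: cvg_cst.
apply: (@continuous_comp _ _ _ (fun y => s * y + t) (fun z => psi.[z] * w z)).
  exact: continuous_affine.
exact: cw.
Qed.

Lemma classical_pearson w : is_classical_weight w ->
  exists phi psi, phi != 0 /\ pearson_weight w phi psi.
Proof.
move=> [w0 [k [s [t [cl _ s0 wE]]]]].
have [phi [psi [phi0 H]]] : exists phi psi, phi != 0 /\ pearson_weight w0 phi psi.
  case: cl => [|a a1|a b a1 b1].
  - exists 1, (- 'X ^+ 2)^`(); split; first exact: oner_neq0.
    have := pearson_expoly (- 'X ^+ 2); congr pearson_weight.
    by apply/funext => x; rewrite hornerN hornerXn.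
  - do 2!eexists; split; last exact: pearson_laguerre.
    by rewrite expf_neq0// polyX_eq0.
  - do 2!eexists; split; last exact: pearson_jacobi.
    rewrite mulf_neq0// expf_neq0//.
      by rewrite -opprB oppr_eq0 polyXsubC_eq0.
    by rewrite addrC -polyC1 -[1]opprK polyCN polyXsubC_eq0.
exists (phi \Po (s *: 'X + t%:P)), (s *: (psi \Po (s *: 'X + t%:P))); split.
  by rewrite comp_poly_eq0// size_polyDl size_scale ?size_polyX// ltnS size_polyC leq_b1.
by have := pearson_affine k s t H; congr pearson_weight; apply/funext => x; rewrite wE.
Qed.

Lemma classical_positive w : is_classical_weight w -> positive_weight w.
Proof.
move=> [w0 [k [s [t [cl k0 s0 wE]]]]].
(* The interval [(0, 1)] lies in the support of all three models; its preimage under [s x + t] is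
   then the required interval, with its ends exchanged when [s < 0]. *)
have [w0_ge0 w0_gt0] : (forall x, 0 <= w0 x) /\ forall x, 0 < x < 1 -> 0 < w0 x.
  case: cl => [|a a1|a b a1 b1]; split=> x.
  - exact: expR_ge0.
  - by rewrite expR_gt0.
  - by case: ifP => // _; rewrite mulr_ge0 ?powR_ge0 ?expR_ge0.
  - by move=> /andP[x0 _]; rewrite x0 mulr_gt0 ?powR_gt0 ?expR_gt0.
  - by case: ifP => // _; rewrite mulr_ge0 ?powR_ge0.
  - move=> /andP[x0 x1]; rewrite x1 andbT (lt_trans _ x0) ?oppr_lt0 ?ltr01//.
    by rewrite mulr_gt0 ?powR_gt0 ?subr_gt0// addr_gt0.
split=> [x|]; first by rewrite wE mulr_ge0// ltW.
have H y : 0 < y < 1 -> 0 < w ((y - t) / s).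
  by move=> y01; rewrite wE mulrCA divff// mulr1 subrK mulr_gt0// w0_gt0.
have [s_gt0|s_le0] := ltP 0 s.
  exists (- t / s), ((1 - t) / s); split; first by rewrite ltr_pM2r ?invr_gt0// lterBDr addrC subrr.
  move=> x /andP[x1 x2]; have -> : x = ((s * x + t) - t) / s by field.
  apply: H; rewrite ltr_pdivrMr// in x1; rewrite ltr_pdivlMr// in x2.
  by apply/andP; split; lra.
have s_lt0 : s < 0 by rewrite lt_neqAle s0.
exists ((1 - t) / s), (- t / s); split; first by rewrite ltr_nM2r ?invr_lt0//; lra.
move=> x /andP[x1 x2]; have -> : x = ((s * x + t) - t) / s by field.
apply: H; rewrite ltr_ndivrMr// in x1; rewrite ltr_ndivlMr// in x2.
by apply/andP; split; lra.
Qed.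

End PearsonWeights.

(** * Gaussian weights with a linear exponent *)

Section GaussianWeights.
Variable R : realType.
Local Notation mu := (@lebesgue_measure R).
Implicit Types (a b c x : R) (p q : {poly R}).

(** The values [d = 2 b] and [d = 0] give the two exponentials occurring in the example. *)
Definition gaussian (d x : R) : R := expR (d * x - x ^+ 2).

Definition gaussian_logder (d : R) : {poly R} := (- 2) *: 'X + d%:P.

Lemma gaussian_pearson d : pearson_weight (gaussian d) 1 (gaussian_logder d).
Proof.
have := pearson_expoly (d *: 'X - 'X ^+ 2); congr pearson_weight.
  by apply/funext => x; rewrite hornerD hornerN hornerZ hornerX hornerXn.
rewrite /gaussian_logder derivD derivZ derivN derivX derivXn addrC expr1.
by rewrite alg_polyC scaleNr scaler_nat.
Qed.

Lemma gaussian_positive d : positive_weight (gaussian d).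
Proof.
split=> [x|]; first exact: expR_ge0.
by exists 0, 1; split=> // x _; exact: expR_gt0.
Qed.

(* |x| ^ n <= n! e^|x| reduces the moments to those of a normal density, as
   2 (|d| + 1) |x| <= x ^ 2 + (|d| + 1) ^ 2. *)
Lemma gaussian_moments d : moments_integrable (gaussian d).
Proof.
move=> n; set k := `|d| + 1.
(* Dividing by the peak turns the standard normal density into [e^(-x^2/2)]; the other factors come
   from the bound on [|x| ^ n] and from completing the square. *)
pose C := n`!%:R * expR (k ^+ 2 / 2) / normal_peak (1 : R).
have pk : 0 < normal_peak (1 : R) by rewrite normal_peak_gt0// oner_neq0.
have iN := integrableZl measurableT C (integrable_normal_pdf (0 : R) 1).
apply: le_integrable iN => //.
  apply/measurable_EFinP; apply: measurable_funM; first exact: measurable_funX.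
  apply: measurableT_comp => //; apply: measurable_funB; last exact: measurable_funX.
  exact: measurable_funM.
move=> x _; rewrite /= lee_fin normrM normrX (ger0_norm (expR_ge0 _)).
apply: le_trans (ler_norm _).
rewrite normal_pdfE ?oner_neq0//= /normal_fun subr0 expr1n.
have -> : C * (normal_peak 1 * expR (- x ^+ 2 / (1 *+ 2))) =
   n`!%:R * expR (k ^+ 2 / 2 - x ^+ 2 / 2).
  by rewrite /C expRD mulNr; field; rewrite gt_eqF.
have xn : `|x| ^+ n <= n`!%:R * expR `|x|.
  case: (n) => [|m]; first by rewrite expr0 fact0 mul1r -expR0 ler_expR.
  have := expR_ge1Dxn m (normr_ge0 x); rewrite -lerBrDl => H.
  rewrite -ler_pdivrMl ?ltr0n ?fact_gt0// mulrC.
  by apply: le_trans H _; rewrite gerBl.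
apply: (@le_trans _ _ (n`!%:R * expR `|x| * expR (d * x - x ^+ 2))).
  by rewrite ler_wpM2r// expR_ge0.
rewrite -mulrA -expRD ler_wpM2l// ler_expR.
have dx : d * x <= `|d| * `|x| by rewrite -normrM ler_norm.
have kx : 0 <= (k - `|x|) ^+ 2 by exact: sqr_ge0.
have x2 : `|x| ^+ 2 = x ^+ 2 by rewrite real_normK// num_real.
rewrite /k in kx *; nra.
Qed.

End GaussianWeights.

(** * The example is a weight matrix *)

Section ExampleWeight.
Variable R : realType.
Local Notation mu := (@lebesgue_measure R).
Implicit Types (a b c x : R) (p q : {poly R}).

(** All entries of the example have this form, which differentiation preserves; smoothness follows
    from this closure. *)
Definition gauss_mix b p q x := p.[x] * gaussian 0 x + q.[x] * gaussian (2 * b) x.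

Lemma W_exampleE a b c x i j : W_example a b c x i j =
  (gauss_mix b (Wgauss a c i j) ((delta_mx 0 0 : 'M[{poly R}]_3) i j) x)%:C.
Proof.
rewrite [LHS]mxE; congr (_%:C).
have g0 : gaussian 0 x = expR (- x ^+ 2) by rewrite /gaussian mul0r add0r.
have gb : gaussian (2 * b) x = expR (- x ^+ 2) * expR (2 * b * x).
  by rewrite /gaussian -expRD addrC.
rewrite /gauss_mix g0 gb /Wgauss !mxE big_ord1 !mxE.
case: i => [[|[|[|//]]] ?]; case: j => [[|[|[|//]]] ?]; rewrite -!val_eqE/= ;
  rewrite !(hornerD, hornerM, hornerZ, hornerX, hornerC, horner0); ring.
Qed.

Lemma is_derive_gauss_mix b p q x : is_derive x 1 (gauss_mix b p q)
  (gauss_mix b (p^`() + p * gaussian_logder 0) (q^`() + q * gaussian_logder (2 * b)) x).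
Proof.
have dg d r : is_derive x 1 (fun y => r.[y] * gaussian d y)
    ((r^`() + r * gaussian_logder d).[x] * gaussian d x).
  have [/(_ x) dG _] := gaussian_pearson d.
  have E : (fun y => (1 : {poly R}).[y] * gaussian d y) = gaussian d.
    by apply/funext => y; rewrite hornerC mul1r.
  rewrite {}E in dG.
  apply: is_derive_eq (is_deriveM (is_derive_poly r x) dG) _.
  rewrite hornerD hornerM /GRing.scale/=; ring.
exact: is_deriveD (dg 0 p) (dg (2 * b) q).
Qed.

Lemma smooth_gauss_mix (D : set R) b p q : smooth_on D (gauss_mix b p q).
Proof.
move=> n x _; have [p' [q' ->]] : exists p' q',
    derive1n n (gauss_mix b p q) = gauss_mix b p' q'.
  elim: n => [|n [p' [q' E]]]; first by exists p, q.
  exists (p'^`() + p' * gaussian_logder 0), (q'^`() + q' * gaussian_logder (2 * b)).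
  apply/funext => y; rewrite derive1nS E derive1E.
  by have [] := is_derive_gauss_mix b p' q' y.
by have [] := is_derive_gauss_mix b p' q' x.
Qed.

Lemma supp_W_example a b c : supp (W_example a b c) = setT.
Proof. by apply/seteqP; split => // x _; split; [exact: ltNyr|exact: ltry]. Qed.

(** The Hermitian form is a sum of squares: [|y0|^2] weighted by one Gaussian, plus [|s|^2 + |y2|^2]
    weighted by the other. If it vanishes, then [y0 = y2 = 0], and [s = 0] gives [y1 = 0]. *)
Lemma posdef_W_example a b c x : posdefmx (W_example a b c x).
Proof.
split.
  apply/is_hermitianmxP; rewrite expr0 scale1r.
  apply/matrixP => i j; rewrite !mxE/= conj_Creal; last first.
    by rewrite complex_real.
  congr (_%:C); congr (_ * _).
  by case: i => [[|[|[|//]]] ?]; case: j => [[|[|[|//]]] ?].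
move=> v v0; pose cr (y : R) : R[i] := y%:C.
have crJ y : Num.conj (cr y) = cr y by rewrite conj_Creal ?complex_real.
pose y0 := v ord0 ord0; pose y1 := v ord0 (lift ord0 ord0).
pose y2 := v ord0 (lift ord0 (lift ord0 ord0)).
pose s := cr (a * x) * y0 + y1 + cr (c * x) * y2.
have -> : (v *m W_example a b c x *m adjmx v) ord0 ord0 =
  cr (gaussian (2 * b) x) * (y0 * Num.conj y0) +
  cr (gaussian 0 x) * (s * Num.conj s + y2 * Num.conj y2).
  have WE i j : W_example a b c x i j =
      cr (gaussian 0 x) * (nth 0 [:: cr (a * x); 1; cr (c * x)] i
                           * nth 0 [:: cr (a * x); 1; cr (c * x)] j
                           + (i == ord_max)%:R * (j == ord_max)%:R)
      + cr (gaussian (2 * b) x) * ((i == ord0)%:R * (j == ord0)%:R).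
    rewrite W_exampleE /gauss_mix /Wgauss !mxE big_ord1 !mxE /cr.
    case: i => [[|[|[|//]]] ?]; case: j => [[|[|[|//]]] ?]; rewrite -!val_eqE/=;
      rewrite !(hornerD, hornerM, hornerZ, hornerX, hornerC, horner0);
      rewrite -?[X in _ = X]/(_%:C) !(rmorphD, rmorphM, rmorph1, rmorph0)/=; ring.
  rewrite mxE 2!big_ord_recl big_ord1 !mxE 2!big_ord_recl !big_ord1 !big_ord_recl !big_ord0.
  rewrite !WE /= -!/y0 -!/y1 -!/y2 /s !(rmorphD, rmorphM) /= !crJ; ring.
have cg d : 0 < cr (gaussian d x) by rewrite ltcR expR_gt0.
have t0 : 0 <= cr (gaussian (2 * b) x) * (y0 * Num.conj y0).
  exact: mulr_ge0 (ltW (cg _)) (mul_conjC_ge0 _).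
have t1 : 0 <= s * Num.conj s + y2 * Num.conj y2.
  exact: addr_ge0 (mul_conjC_ge0 _) (mul_conjC_ge0 _).
have t2 := mulr_ge0 (ltW (cg 0)) t1.
rewrite lt0r (addr_ge0 t0 t2) andbT; apply: contra v0.
rewrite (paddr_eq0 t0 t2) !mulf_eq0 !(gt_eqF (cg _))/= -!mulf_eq0.
rewrite (paddr_eq0 (mul_conjC_ge0 _) (mul_conjC_ge0 _)).
rewrite !mul_conjC_eq0 => /andP[/eqP e0 /andP[/eqP es /eqP e2]].
have e1 : y1 = 0 by rewrite -es /s e0 e2 !mulr0 add0r addr0.
apply/eqP/rowP => k; rewrite [RHS]mxE.
case: k => [[|[|[|//]]] ?].
- by rewrite -[RHS]e0; congr (v _ _); apply: val_inj.
- by rewrite -[RHS]e1; congr (v _ _); apply: val_inj.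
- by rewrite -[RHS]e2; congr (v _ _); apply: val_inj.
Qed.

Lemma W_example_is_weight a b c : is_weight_matrix (W_example a b c).
Proof.
have ReE i j : (fun x => complex.Re (W_example a b c x i j)) =
    gauss_mix b (Wgauss a c i j) ((delta_mx 0 0 : 'M[{poly R}]_3) i j).
  by apply/funext => x; rewrite W_exampleE.
have ImE i j : (fun x => complex.Im (W_example a b c x i j)) = gauss_mix b 0 0.
  by apply/funext => x; rewrite W_exampleE /gauss_mix horner0 !mul0r addr0.
split.
- by [].
- by move=> i j; rewrite ReE ImE; split; exact: smooth_gauss_mix.
- by apply: aeW => x _; exact: posdef_W_example.
- by move=> x; rewrite supp_W_example => /(_ I).
- move=> n i j; rewrite supp_W_example.
  have key p q : mu.-integrable setT (EFin \o (fun x => x ^+ n * gauss_mix b p q x)).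
    have := integrableD measurableT
      (poly_integrable ('X^n * p) (gaussian_moments 0))
      (poly_integrable ('X^n * q) (gaussian_moments (2 * b))).
    congr (mu.-integrable _ _); apply/funext => x /=.
    rewrite -EFinD /gauss_mix !hornerM !hornerXn; congr (_%:E); ring.
  split; [have := key (Wgauss a c i j) ((delta_mx 0 0 : 'M[{poly R}]_3) i j)|have := key 0 0];
  congr (mu.-integrable _ (EFin \o _)); apply/funext => x.
    by rewrite -ReE.
  by rewrite -(ImE i j).
Qed.
End ExampleWeight.

(** * From rational to polynomial operator identities *)

Section FractionActions.
Variables (R : realType) (N : nat).
Implicit Types (P : 'M[{poly R[i]}]_N) (D : seq 'M[{poly R[i]}]_N) (F : {poly R[i]}).

Lemma frac_deriv_tofrac (K : fieldType) (p : {poly K}) :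
  frac_deriv (tofrac p) = tofrac p^`().
Proof.
have := frac_derivE p (oner_neq0 {poly K}).
by rewrite derivC mulr0 subr0 mulr1 expr1n !tofrac1 !divr1.
Qed.

Lemma rat_act_to_rat P D :
  rat_act (to_rat P) [seq to_rat G | G <- D] = to_rat (poly_act P D).
Proof.
have it s (p : {poly R[i]}) :
    iter s (@frac_deriv R[i]) (tofrac p) = tofrac (iter s (@deriv R[i]) p).
  by elim: s => //= s ->; rewrite frac_deriv_tofrac.
rewrite /rat_act /poly_act /act size_map /to_rat map_mx_sum.
apply: eq_bigr => s _; rewrite map_mxM; congr (_ *m _).
  by apply/matrixP => i j; rewrite !mxE it.
by rewrite (nth_map 0).
Qed.

Lemma rat_act_mul_inv (M : 'M[{fraction {poly R[i]}}]_N) F :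
  rat_act M (mul_inv N F) = (tofrac F)^-1 *: M.
Proof.
rewrite /rat_act /act big_ord1/= (_ : map_mx _ M = M) ?mul_mx_scalar//.
by apply/matrixP => i j; rewrite mxE.
Qed.

Lemma darboux_relation P Q D F : F != 0 ->
  to_rat Q = rat_act (rat_act (to_rat P) [seq to_rat G | G <- D]) (mul_inv N F) ->
  act (@deriv R[i]) P D = F *: Q.
Proof.
move=> F0; rewrite rat_act_mul_inv rat_act_to_rat => /matrixP E.
apply/matrixP => i j; have := E i j; rewrite !mxE => {}E.
apply/eqP; rewrite -tofrac_eq tofracM E mulVKf// tofrac_eq0//.
Qed.

End FractionActions.

(** * Inner products expressed by moment functionals *)

Section InnerProducts.
Variables (R : realType).
Local Notation mu := (@lebesgue_measure R).
Local Notation cmx X := (map_mx polyC X).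

(** At every real point its value is the adjoint of the value of [Q], so the inner product of [P]
    and [Q] becomes bilinear in [P] and [conjT Q]. *)
Definition conjT N (Q : 'M[{poly R[i]}]_N) : 'M[{poly R[i]}]_N :=
  map_mx (map_poly Num.conj) Q^T.

Lemma conjTK N : involutive (@conjT N).
Proof.
move=> Q; apply/matrixP => i j; rewrite !mxE; apply/polyP => k.
by rewrite !coef_map/= conjCK.
Qed.

Lemma conjT_cmul N X (Q : 'M[{poly R[i]}]_N) :
  conjT (cmx X *m Q) = conjT Q *m cmx (adjmx X).
Proof.
rewrite /conjT trmx_mul map_mxM; congr (_ *m _).
by apply/matrixP => i j; rewrite !mxE /= map_polyC.
Qed.

Lemma evalmxM N (P Q : 'M[{poly R[i]}]_N) x :
  evalmx (P *m Q) x = evalmx P x *m evalmx Q x.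
Proof.
apply/matrixP => i j; rewrite !mxE horner_sum; apply: eq_bigr => k _.
by rewrite hornerM !mxE.
Qed.

Lemma adjmx_evalmx N (Q : 'M[{poly R[i]}]_N) x : adjmx (evalmx Q x) = evalmx (conjT Q) x.
Proof.
apply/matrixP => i j; rewrite !mxE.
have xJ : Num.conj (x%:C : R[i]) = x%:C by rewrite conj_Creal ?complex_real.
by rewrite -[in RHS]xJ horner_map.
Qed.

Lemma cintegral_mkcond (D : set R) (f : R -> R[i]) :
  (forall x, ~ D x -> f x = 0) -> cintegral D f = cintegral setT f.
Proof.
move=> f0; rewrite /cintegral [in LHS]Rintegral_mkcond.
rewrite [X in _ +i* X = _]Rintegral_mkcond.
by congr (_ +i* _); apply: eq_Rintegral => x _; rewrite patchE;
  case: ifPn => // /negP; rewrite inE => /f0 ->.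
Qed.

Lemma inner_W_example a b c (P Q : 'M[{poly R[i]}]_3) :
  inner (W_example a b c) P Q =
  map_mx (mom (gaussian (2 * b))) (P *m delta_mx 0 0 *m conjT Q) +
  map_mx (mom (gaussian 0)) (P *m Wgauss a%:C c%:C *m conjT Q).
Proof.
have WE x : W_example a b c x =
    (gaussian (2 * b) x)%:C *: evalmx (delta_mx 0 0) x +
    (gaussian 0 x)%:C *: evalmx (Wgauss a%:C c%:C) x.
  apply/matrixP => i j; rewrite W_exampleE /gauss_mix rmorphD !rmorphM/= addrC.
  rewrite [RHS]mxE; congr (_ + _); rewrite [RHS]mxE [LHS]mulrC; congr (_ * _).
    by rewrite !mxE; case: (_ && _); rewrite ?hornerC ?horner0.
  rewrite [RHS]mxE (_ : Wgauss a%:C c%:C = map_mx (map_poly (real_complex R)) (Wgauss a c)).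
    by rewrite [map_mx _ _ i j]mxE (horner_map (real_complex R)).
  apply/matrixP => i' j'; rewrite !mxE !big_ord1 !mxE rmorphD rmorphM rmorph_nat.
  have E k : nth 0 [:: a%:C *: 'X; 1; c%:C *: 'X] k =
      map_poly (real_complex R) (nth 0 [:: a *: 'X; 1; c *: 'X] k).
    case: k => [|[|[|k]]]/=; rewrite ?map_polyZ/= ?map_polyX ?rmorph1 ?rmorph0//.
    by rewrite !nth_nil rmorph0.
  by rewrite !E.
apply/matrixP => i j; rewrite [LHS]mxE supp_W_example.
transitivity (mom (gaussian (2 * b)) ((P *m delta_mx 0 0 *m conjT Q) i j) +
  mom (gaussian 0) ((P *m Wgauss a%:C c%:C *m conjT Q) i j)); last by rewrite !mxE.
have [E1 I1] := cintegral_mom ((P *m delta_mx 0 0 *m conjT Q) i j) (gaussian_moments (2 * b)).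
have [E2 I2] := cintegral_mom ((P *m Wgauss a%:C c%:C *m conjT Q) i j)
  (gaussian_moments (0 : R)).
rewrite -E1 -E2 -cintegralD//; congr cintegral; apply/funext => x.
rewrite adjmx_evalmx WE mulmxDr mulmxDl -!scalemxAr -!scalemxAl -!evalmxM.
rewrite [LHS]mxE; congr (_ + _); rewrite [LHS]mxE [LHS]mulrC; congr (_ * _).
  by rewrite mxE.
by rewrite mxE.
Qed.

Lemma measurable_supp N (V : matrix_fun R N) :
  measurable (supp V : set (measurableTypeR R)).
Proof.
have mo (u : \bar R) : measurable ([set x : R | (u < x%:E)%E] : set (measurableTypeR R)).
  case: u => [r||].
  - suff -> : [set x : R | (r%:E < x%:E)%E] = `]r, +oo[%classic by [].
    by apply/seteqP; split => x /=; rewrite in_itv/= lte_fin andbT.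
  - suff -> : [set x : R | (+oo < x%:E)%E] = set0 by [].
    by rewrite -subset0.
  - suff -> : [set x : R | (-oo < x%:E)%E] = setT by [].
    by rewrite -subTset => x _ /=; exact: ltNyr.
have mu' (u : \bar R) : measurable ([set x : R | (x%:E < u)%E] : set (measurableTypeR R)).
  case: u => [r||].
  - suff -> : [set x : R | (x%:E < r%:E)%E] = `]-oo, r[%classic by [].
    by apply/seteqP; split => x /=; rewrite in_itv/= lte_fin.
  - suff -> : [set x : R | (x%:E < +oo)%E] = setT by [].
    by rewrite -subTset => x _ /=; exact: ltry.
  - suff -> : [set x : R | (x%:E < -oo)%E] = set0 by [].
    by rewrite -subset0.
exact: measurableI (mo _) (mu' _).
Qed.

Lemma direct_sum_moments N (V : matrix_fun R N) (w : 'I_N -> R -> R) :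
  is_weight_matrix V -> (forall x, V x = diag_mx (\row_i (w i x)%:C)) ->
  forall i, moments_integrable (w i).
Proof.
move=> [_ _ _ V0 mV] VE i n; have [+ _] := mV n i i.
move=> /(integrable_mkcond _ (measurable_supp V)); congr (mu.-integrable _ _).
apply/funext => x; rewrite patchE /=; case: ifPn => [_|/negP].
  by rewrite VE !mxE eqxx.
rewrite inE => /V0; rewrite VE => /matrixP/(_ i i); rewrite !mxE eqxx => -[->].
by rewrite mulr0.
Qed.

Lemma inner_direct_sum N (V : matrix_fun R N) (w : 'I_N -> R -> R) P Q :
  is_weight_matrix V -> (forall x, V x = diag_mx (\row_i (w i x)%:C)) ->
  inner V P Q = diag_pair (fun k => mom (w k)) P (conjT Q).
Proof.
move=> wV VE; have mom_w := direct_sum_moments wV VE.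
have [_ _ _ V0 _] := wV.
apply/matrixP => i j; rewrite [LHS]mxE [RHS]mxE cintegral_mkcond; last first.
  by move=> x /V0 ->; rewrite mulmx0 mul0mx mxE.
have cm k := cintegral_mom (P i k * conjT Q k j) (mom_w k).
rewrite -(eq_bigr _ (fun k _ => (cm k).1)).
have [<- _] := cintegral_sum (index_enum 'I_N) (fun k => (cm k).2).
congr cintegral; apply/funext => x; rewrite adjmx_evalmx VE mul_mx_diag mxE.
by apply: eq_bigr => k _; rewrite !mxE hornerM mulrAC.
Qed.

(** A vector of the left kernel, repeated in all rows of [X], makes [X P] a matrix of norm zero. The
    diagonal of its Gram matrix consists of sums of nonnegative terms, so [X P = 0]; as [P] is
    monic, [X] is its leading coefficient and vanishes. *)
Lemma gram_unit N (w : 'I_N -> R -> R) n (P : 'M[{poly R[i]}]_N) :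
  (forall k, moments_integrable (w k)) -> (forall k, positive_weight (w k)) ->
  size_le n (P - ('X^n)%:M) ->
  diag_pair (fun k => mom (w k)) P (conjT P) \in unitmx.
Proof.
move=> iw pw monP; set H := diag_pair _ _ _.
rewrite -row_free_unit -kermx_eq0; apply/negPn/negP => /rowV0Pn[u uH u0].
pose X : 'M[R[i]]_N := \matrix_(i, j) u ord0 j.
have XH : X *m H = 0.
  apply/row_matrixP => i; rewrite row_mul row0 (_ : row i X = u) ?(sub_kermxP uH)//.
  by apply/rowP => j; rewrite !mxE.
have : diag_pair (fun k => mom (w k)) (cmx X *m P) (conjT (cmx X *m P)) = 0.
  by rewrite conjT_cmul diag_pair_cmulr diag_pair_cmull -/H XH mul0mx.
set Y := cmx X *m P => /matrixP Y0.
have : Y = 0.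
  apply/matrixP => i j; have := Y0 i i; rewrite !mxE => /eqP.
  rewrite psumr_eq0 => [/allP/(_ j (mem_index_enum _))/=|k _].
    by rewrite !mxE => /eqP; exact: mom_conj_eq0.
  by rewrite !mxE; exact: mom_conj_ge0.
move=> /matrixP YE; move/eqP: u0; apply; apply/rowP => j.
by have := coef_cmul_monic X j j monP; rewrite -/Y YE !mxE coef0.
Qed.

(** Coefficient matrices in the second argument come out on the right as adjoints, so orthogonality
    to each [Q m] is enough. *)
Lemma inner_W_span a b c P (Q : nat -> 'M[{poly R[i]}]_3) (X : nat -> 'M[R[i]]_3) M :
  (forall m, (m < M)%N -> inner (W_example a b c) P (Q m) = 0) ->
  inner (W_example a b c) P (\sum_(m < M) cmx (X m) *m Q m) = 0.
Proof.
move=> PQ; have conjT_sum : conjT (\sum_(m < M) cmx (X m) *m Q m) =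
    \sum_(m < M) conjT (Q m) *m cmx (adjmx (X m)).
  rewrite /conjT raddf_sum map_mx_sum; apply: eq_bigr => m _.
  by rewrite -[RHS]conjT_cmul.
rewrite inner_W_example conjT_sum !mulmx_sumr !map_mx_sum -big_split big1//= => m _.
rewrite !(mulmxA (_ *m _)) !map_functionalMr -mulmxDl -inner_W_example PQ//.
exact: mul0mx.
Qed.

End InnerProducts.

Theorem theorem5p4 (R : realType) (a b c : R)
    (ha : a != 0) (hb : b != 0) (hc : c != 0) :
  is_weight_matrix (W_example a b c) /\
  forall V : matrix_fun R 3,
    is_classical_direct_sum V -> ~ is_darboux V (W_example a b c).
Proof.
split; first exact: W_example_is_weight.
move=> V [wV [w [clw VE]]] [P [Q [[monP orthP] [monQ orthQ]
  [D [Dt [F [Ft [C [Ct [_ [F0 _] [finC _] PQ _]]]]]]]]]].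
have iw := direct_sum_moments wV VE.
have pw k := classical_positive (clw k).
have PD n := darboux_relation F0 (PQ n).
have /choice[phi /choice[psi Hw]] k := classical_pearson (clw k).
pose rpoly := map_poly (real_complex R).
(* The logarithmic derivative of [e^(-x^2)]; the one of [e^(-x^2+2bx)] differs from it by the
   constant [2 b], which is nonzero by [hb]. *)
pose l := rpoly ((- 2) *: 'X).
have r1 : rpoly 1 = 1 by exact: rmorph1.
have gl : pearson_functional (mom (gaussian (2 * b))) 1 (l + (2 * b)%:C%:P).
  have := mom_pearson (gaussian_pearson (2 * b)) (gaussian_moments _).
  by rewrite -/rpoly r1 /gaussian_logder [rpoly _]rmorphD/= map_polyC.
have hl : pearson_functional (mom (gaussian (0 : R))) 1 l.
  have := mom_pearson (gaussian_pearson (0 : R)) (gaussian_moments _).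
  by rewrite -/rpoly r1 /gaussian_logder addr0.
have d0 : (2 * b)%:C != 0 :> R[i] by rewrite fmorph_eq0 mulf_neq0// pnatr_eq0.
have sep (d : R) := mom_separating (gaussian_moments d) (gaussian_positive d).
have a0 : a%:C != 0 :> R[i] by rewrite fmorph_eq0.
have pearson_w k : rpoly (phi k) != 0 /\
    pearson_functional (mom (w k)) (rpoly (phi k)) (rpoly (psi k)).
  by have [phi0 pk] := Hw k; rewrite map_poly_eq0; split=> //; exact: mom_pearson.
have orth n m : n != m -> diag_pair (fun k => mom (w k)) (P n) (conjT (P m)) = 0.
  by move=> nm; rewrite -(inner_direct_sum _ _ wV VE) orthP.
have gram n : diag_pair (fun k => mom (w k)) (P n) (conjT (P n)) \in unitmx.
  exact: gram_unit (monP n).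
have van (S : 'M[{poly R[i]}]_3) : exists M, forall n, (M <= n)%N ->
    map_mx (mom (gaussian (2 * b))) (act (@deriv R[i]) (P n) D *m delta_mx 0 0 *m S) +
    map_mx (mom (gaussian 0)) (act (@deriv R[i]) (P n) D *m Wgauss a%:C c%:C *m S) = 0.
  (* The factor [F] is moved to the test matrix, and [conjT] undoes the adjoint in [inner]. From its
     size bound [M] on, [Q n] is orthogonal to this matrix. *)
  have [M hM] := size_le_ex (conjT (F *: S)).
  have [X EX] := monic_span monQ hM.
  exists M => n Mn; rewrite PD.
  have E T : F *: (map_mx polyC (C n) *m Q n) *m T *m S =
      map_mx polyC (C n) *m (Q n *m T *m conjT (conjT (F *: S))).
    by rewrite conjTK -!scalemxAl -!scalemxAr !mulmxA.
  rewrite !E !map_functionalMl -mulmxDr -inner_W_example EX inner_W_span ?mulmx0//.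
  by move=> m mM; rewrite orthQ// gtn_eqF// (leq_trans mM).
have rows := operator_rows_split d0 gl hl (sep _) (sep _) pearson_w monP orth gram van.
have column0 := leading_column0 a0 F0 monP monQ PD rows.
(* A matrix with zero first column is singular, so all natural numbers would lie in the finite set
   of exceptions for [C]. *)
apply: infinite_nat; apply: sub_finite_set finC => n _ /=.
apply/negP => Cn; have /matrixP/(_ 0 0) := mulVmx Cn.
rewrite !mxE big1 => [|k _]; last by rewrite column0 mulr0.
by move/eqP; rewrite eqxx eq_sym oner_eq0.
Qed.
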